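(* Let $(A,G,\alpha)$ be a C*-dynamical system. Then $(A,G,\alpha)$ has the intersection property if and only if every pseudo-expectation for $(A,G,\alpha)$ is faithful.
   Context: A C*-dynamical system $(A,G,\alpha)$ consists of a unital C*-algebra $A$, a countable discrete group $G$ and a group homomorphism $\alpha:G\to\operatorname{Aut}(A)$. Ideals are closed and two-sided. $A\times_r G$ denotes the reduced crossed product, with canonical unitaries $\lambda_s$ satisfying $\lambda_sa\lambda_s^*=\alpha_s(a)$; $G$ acts on $A\times_r G$ by conjugation by the $\lambda_s$. $(A,G,\alpha)$ has the intersection property if $A\cap J\neq 0$ for every nonzero ideal $J$ of $A\times_r G$. Injective hull. A noncommutative dynamical system $(S,G)$ is an operator system $S$ with an action of $G$ by unital complete order isomorphisms. Morphisms are $G$-equivariant unital completely positive maps; an embedding is a morphism that is a complete order injection. An extension of $S$ is a pair $(T,\iota)$ with $\iota:S\to T$ an embedding; it is essential if every morphism $\phi:T\to R$ such that $\phi\circ\iota$ is an embedding is itself an embedding. $R$ is injective if for every extension $(T,\iota)$ of $S$ and every morphism $\phi:S\to R$ there is a morphism $\psi:T\to R$ with $\psi\circ\iota=\phi$. The injective hull $(I_G(A),G,I_G(\alpha))$ of $(A,G,\alpha)$ is its minimal injective extension (equivalently, the extension that is injective and essential), unique up to isomorphism; it is a C*-dynamical system and $A\subseteq I_G(A)$. A pseudo-expectation for $(A,G,\alpha)$ is a $G$-equivariant unital completely positive map $\phi:A\times_r G\to I_G(A)$ with $\phi|_A=\operatorname{id}|_A$. It is faithful if $\phi(x^*x)=0$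 implies $x=0$. *)

(* Defs.v *)
From HB Require Import structures.
From mathcomp Require Import all_boot all_order all_algebra.
From mathcomp Require Import finmap complex.
From mathcomp Require Import all_classical all_reals all_analysis.
Import Order.TTheory GRing.Theory Num.Theory.
Import numFieldNormedType.Exports.

Set Implicit Arguments.
Unset Strict Implicit.
Unset Printing Implicit Defensive.

Local Open Scope classical_set_scope.
Local Open Scope ring_scope.
Local Open Scope complex_scope.

(* No axiom [1 != 0]: the zero algebra is allowed. *)
HB.mixin Record isCstarAlgebra (R : realType) A
    of CompleteNormedModule R[i] A := {
  cstar_one : A;
  cstar_mul : A -> A -> A;
  star : A -> A;
  cstar_mulA : associative cstar_mul;
  cstar_mul1l : left_id cstar_one cstar_mul;
  cstar_mul1r : right_id cstar_one cstar_mul;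
  cstar_mulDl : left_distributive cstar_mul +%R;
  cstar_mulDr : right_distributive cstar_mul +%R;
  cstar_mulZl : forall (k : R[i]) (x y : A),
    cstar_mul (k *: x) y = k *: cstar_mul x y;
  cstar_mulZr : forall (k : R[i]) (x y : A),
    cstar_mul x (k *: y) = k *: cstar_mul x y;
  starK : involutive star;
  starD : {morph star : x y / x + y};
  starZ : forall (k : R[i]) (x : A), star (k *: x) = Num.conj k *: star x;
  cstar_starM : forall x y : A,
    star (cstar_mul x y) = cstar_mul (star y) (star x);
  cstar_normM : forall x y : A, `|cstar_mul x y| <= `|x| * `|y|;
  cstar_norm : forall x : A, `|cstar_mul (star x) x| = `|x| ^+ 2
}.

#[short(type="cstarType")]
HB.structure Definition CstarAlgebra (R : realType) :=
  {A of CompleteNormedModule R[i] A & isCstarAlgebra R A}.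

(* The ring structure is derived from the C*-algebra structure instead of being
   inherited by it, because the hierarchy has no join of rings and normed
   modules below the numeric fields. *)
#[non_forgetful_inheritance]
HB.instance Definition _ (R : realType) (A : cstarType R) :=
  GRing.Zmodule_isPzRing.Build A (@cstar_mulA R A) (@cstar_mul1l R A)
    (@cstar_mul1r R A) (@cstar_mulDl R A) (@cstar_mulDr R A).

Section CstarAlgebras.
Context {R : realType}.

Lemma starM (A : cstarType R) (x y : A) : star (x * y) = star y * star x.
Proof. exact: cstar_starM. Qed.

Lemma cstar_scalerAl (A : cstarType R) (k : R[i]) (x y : A) :
  k *: (x * y) = (k *: x) * y.
Proof. by rewrite [RHS]cstar_mulZl. Qed.

Lemma cstar_scalerAr (A : cstarType R) (k : R[i]) (x y : A) :
  k *: (x * y) = x * (k *: y).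
Proof. by rewrite [RHS]cstar_mulZr. Qed.

Lemma star1 (A : cstarType R) : star (1 : A) = 1.
Proof. by rewrite -[RHS]starK -[star 1 in RHS]mul1r starM starK mul1r. Qed.

Definition star_hom (A B : cstarType R) (f : A -> B) : Prop :=
  [/\ linear f, {morph f : x y / x * y}, f 1 = 1 & {morph f : x / star x}].

Definition mxstar (A : cstarType R) n (X : 'M[A]_n) : 'M[A]_n :=
  map_mx star X^T.

(* The positive elements of the C*-algebra M_n(A) are those of the form Y^* Y. *)
Definition mxpos (A : cstarType R) n (X : 'M[A]_n) : Prop :=
  exists Y : 'M[A]_n, X = mxstar Y *m Y.

Definition cstar_ideal (A : cstarType R) (J : set A) : Prop :=
  [/\ J 0, forall x y, J x -> J y -> J (x + y),
      forall (k : R[i]) x, J x -> J (k *: x),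
      forall x y, J y -> J (x * y) /\ J (y * x) & closed J].

End CstarAlgebras.

(* An operator system is a unital self-adjoint subspace of a unital
   C*-algebra; the subspace is presented as a vector space with an injective
   linear map [os_emb] to the C*-algebra. *)

Record opsys (R : realType) := Opsys {
  os_sort :> lmodType R[i];
  os_amb : cstarType R;
  os_emb : os_sort -> os_amb;
  os_emb_linear : linear os_emb;
  os_emb_inj : injective os_emb;
  os_one : os_sort;
  os_oneE : os_emb os_one = 1;
  os_star : os_sort -> os_sort;
  os_starE : forall x, os_emb (os_star x) = star (os_emb x)
}.

Section OperatorSystems.
Context {R : realType}.

(* M_n(S)+, which is the intersection of M_n(S) with the positive cone of the
   matrices over the ambient C*-algebra *)
Definition os_pos (S : opsys R) n (X : 'M[S]_n) : Prop :=
  mxpos (map_mx (@os_emb R S) X).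

Definition ucp (S T : opsys R) (f : S -> T) : Prop :=
  [/\ linear f, f (os_one S) = os_one T &
      forall n (X : 'M[S]_n), os_pos X -> os_pos (map_mx f X)].

Definition complete_order_injection (S T : opsys R) (f : S -> T) : Prop :=
  injective f /\
  forall n (X : 'M[S]_n), os_pos X <-> os_pos (map_mx f X).

Lemma cstar_emb_linear (A : cstarType R) : linear (id : A -> A).
Proof. by []. Qed.

Definition opsys_of_cstar (A : cstarType R) : opsys R :=
  @Opsys R A A id (@cstar_emb_linear A) (@inj_id A) 1 (erefl _) star
    (fun=> erefl _).

Lemma map_mxstar (A B : cstarType R) (f : A -> B) n (Y : 'M[A]_n) :
  star_hom f -> map_mx f (mxstar Y *m Y) = mxstar (map_mx f Y) *m map_mx f Y.
Proof.
move=> [fL fM f1 fs]; apply/matrixP => i j; rewrite !mxE.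
have f0 : f 0 = 0 by have := fL (-1) 0 0; rewrite scaler0 addr0 scaleN1r addNr.
have fD x y : f (x + y) = f x + f y by have := fL 1 x y; rewrite !scale1r.
rewrite (big_morph f fD f0); apply: eq_bigr => k _.
by rewrite fM !mxE fs.
Qed.

Lemma star_hom_ucp (A B : cstarType R) (f : A -> B) : star_hom f ->
  @ucp (opsys_of_cstar A) (opsys_of_cstar B) f.
Proof.
move=> fH; case: (fH) => fL fM f1 fs; split=> // n X [Y].
rewrite /= map_mx_id // => ->; exists (map_mx f Y).
by rewrite map_mx_id // map_mxstar.
Qed.

Lemma star_hom_coi (A B : cstarType R) (f : A -> B) (g : B -> A) :
  star_hom f -> star_hom g -> cancel f g ->
  @complete_order_injection (opsys_of_cstar A) (opsys_of_cstar B) f.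
Proof.
move=> fH gH fK; split; first exact: can_inj fK.
move=> n X; split; first by case: (star_hom_ucp fH) => _ _; apply.
case: (star_hom_ucp gH) => _ _ /(_ n (map_mx f X)) h /h.
rewrite -map_mx_comp map_mx_id //.
Qed.

End OperatorSystems.

(* [G] acts by [*]-automorphisms: bijectivity of [cds_act s] follows from the
   last two fields. *)
Record cstar_dynsys (R : realType) (G : groupType) := CstarDynsys {
  cds_alg :> cstarType R;
  cds_act : G -> cds_alg -> cds_alg;
  cds_act_hom : forall s, star_hom (cds_act s);
  cds_act1 : forall x, cds_act 1%g x = x;
  cds_actM : forall s t x, cds_act (s * t)%g x = cds_act s (cds_act t x)
}.

(* Noncommutative dynamical systems; [nds_act s] is bijective as above, hence
   a unital complete order isomorphism. *)
Record nc_dynsys (R : realType) (G : groupType) := NcDynsys {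
  nds_os :> opsys R;
  nds_act : G -> nds_os -> nds_os;
  nds_act_ucp : forall s, ucp (nds_act s);
  nds_act_coi : forall s, complete_order_injection (nds_act s);
  nds_act1 : forall x, nds_act 1%g x = x;
  nds_actM : forall s t x, nds_act (s * t)%g x = nds_act s (nds_act t x)
}.

Section DynamicalSystems.
Context {R : realType} {G : groupType}.

Lemma cds_act_coi (A : cstar_dynsys R G) s :
  @complete_order_injection R (opsys_of_cstar A) (opsys_of_cstar A)
    (cds_act s).
Proof.
apply: (star_hom_coi (cds_act_hom A s) (cds_act_hom A s^-1%g)) => x.
by rewrite -cds_actM mulVg cds_act1.
Qed.

Definition nds_of_cds (A : cstar_dynsys R G) : nc_dynsys R G :=
  @NcDynsys R G (opsys_of_cstar A) (@cds_act R G A)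
    (fun s => star_hom_ucp (cds_act_hom A s)) (@cds_act_coi A)
    (@cds_act1 R G A) (@cds_actM R G A).

Definition equivariant (S T : nc_dynsys R G) (f : S -> T) : Prop :=
  forall s x, f (nds_act s x) = nds_act s (f x).

Definition nds_morphism (S T : nc_dynsys R G) (f : S -> T) : Prop :=
  ucp f /\ equivariant f.

Definition nds_embedding (S T : nc_dynsys R G) (f : S -> T) : Prop :=
  nds_morphism f /\ complete_order_injection f.

Definition essential_extension (S T : nc_dynsys R G) (i : S -> T) : Prop :=
  nds_embedding i /\
  forall (U : nc_dynsys R G) (f : T -> U), nds_morphism f ->
    nds_embedding (f \o i) -> nds_embedding f.

Definition nds_injective (U : nc_dynsys R G) : Prop :=
  forall (S T : nc_dynsys R G) (i : S -> T) (f : S -> U),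
    nds_embedding i -> nds_morphism f ->
    exists2 g : T -> U, nds_morphism g & forall x, g (i x) = f x.

End DynamicalSystems.

(* The injective hull of a C*-dynamical system is again a C*-dynamical system,
   and contains the given one as a C*-subalgebra ([hull_incl_hom]). *)
Record injective_hull (R : realType) (G : groupType)
    (A : cstar_dynsys R G) := InjectiveHull {
  hull_cds :> cstar_dynsys R G;
  hull_incl : A -> hull_cds;
  hull_incl_hom : star_hom hull_incl;
  hull_essential :
    @essential_extension R G (nds_of_cds A) (nds_of_cds hull_cds) hull_incl;
  hull_injective : nds_injective (nds_of_cds hull_cds)
}.

Record hilbert (R : realType) := Hilbert {
  hilb_sort :> completeNormedModType R[i];
  hilb_dot : {dot hilb_sort for Num.conj};
  hilb_norm : forall x, `|x| ^+ 2 = hilb_dot x x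
}.

Section RegularRepresentation.
Context {R : realType} {G : groupType}.

(* Norms take values in R[i]; this is the real number they represent. *)
Definition rnorm (V : normedModType R[i]) (x : V) : R := complex.Re `|x|.

Definition faithful_rep (A : cstarType R) (H : hilbert R)
    (p : A -> H -> H) : Prop :=
  [/\ forall a, linear (p a) /\ continuous (p a),
      forall k a b x, p (k *: a + b) x = k *: p a x + p b x,
      (forall a b x, p (a * b) x = p a (p b x)) /\ (forall x, p 1 x = x),
      forall a x y, hilb_dot H (p a x) y = hilb_dot H x (p (star a) y) &
      injective p].

(* The norm of l^2(G, H), with value +oo outside of l^2(G, H) *)
Definition l2norm (H : hilbert R) (xi : G -> H) : \bar R :=
  sqrte (\esum_(t in [set: G]) ((rnorm (xi t)) ^+ 2)%:E).

(* The operator on l^2(G, H) given by the element [\sum_(s in F) a_s s] of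
   C_c(G, A), under the regular representation
     (a xi)(t) = p (alpha_(t^-1) a) (xi t),  (s xi)(t) = xi (s^-1 t) *)
Definition regular_rep (A : cstar_dynsys R G) (H : hilbert R)
    (p : A -> H -> H) (F : {fset G}) (a : G -> A) (xi : G -> H) : G -> H :=
  fun t => \sum_(s <- F) p (cds_act t^-1%g (a s)) (xi (s^-1 * t)%g).

Definition reduced_norm (A : cstar_dynsys R G) (H : hilbert R)
    (p : A -> H -> H) (F : {fset G}) (a : G -> A) : \bar R :=
  ereal_sup [set l2norm (regular_rep p F a xi) |
             xi in [set xi : G -> H | (l2norm xi <= 1)%E]].

End RegularRepresentation.

(* A x_r G is the completion of C_c(G, A) in the reduced norm, which does not
   depend on the faithful representation of [A] used to define it. *)
Record reduced_crossed_product (R : realType) (G : groupType)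
    (A : cstar_dynsys R G) := ReducedCrossedProduct {
  rcp_alg :> cstarType R;
  rcp_incl : A -> rcp_alg;
  rcp_unitary : G -> rcp_alg;
  rcp_incl_hom : star_hom rcp_incl;
  rcp_unitaryl : forall s, star (rcp_unitary s) * rcp_unitary s = 1;
  rcp_unitaryr : forall s, rcp_unitary s * star (rcp_unitary s) = 1;
  rcp_unitary1 : rcp_unitary 1%g = 1;
  rcp_unitaryM : {morph rcp_unitary : s t / (s * t)%g >-> s * t};
  rcp_covariant : forall s a,
    rcp_unitary s * rcp_incl a * star (rcp_unitary s) =
    rcp_incl (cds_act s a);
  rcp_dense : closure [set x : rcp_alg | exists (F : {fset G}) (a : G -> A),
    x = \sum_(s <- F) rcp_incl (a s) * rcp_unitary s] = [set: rcp_alg];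
  rcp_norm : exists (H : hilbert R) (p : A -> H -> H), faithful_rep p /\
    forall (F : {fset G}) (a : G -> A),
      (rnorm (\sum_(s <- F) rcp_incl (a s) * rcp_unitary s))%:E =
      reduced_norm p F a
}.

Section CrossedProducts.
Context {R : realType} {G : groupType} {A : cstar_dynsys R G}.
Variable B : reduced_crossed_product A.

Definition rcp_conj (s : G) (x : B) : B :=
  rcp_unitary B s * x * star (rcp_unitary B s).

Lemma rcp_conj_hom s : star_hom (rcp_conj s).
Proof.
rewrite /rcp_conj; split.
- by move=> k x y; rewrite mulrDr mulrDl -cstar_scalerAr -cstar_scalerAl.
- move=> x y; rewrite -!mulrA; congr (_ * (_ * _)).
  by rewrite [in RHS]mulrA rcp_unitaryl mul1r.
- by rewrite mulr1 rcp_unitaryr.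
- by move=> x; rewrite !starM starK mulrA.
Qed.

Lemma rcp_conj1 x : rcp_conj 1%g x = x.
Proof. by rewrite /rcp_conj rcp_unitary1 star1 mul1r mulr1. Qed.

Lemma rcp_conjM s t x : rcp_conj (s * t)%g x = rcp_conj s (rcp_conj t x).
Proof. by rewrite /rcp_conj rcp_unitaryM starM !mulrA. Qed.

Definition rcp_cds : cstar_dynsys R G :=
  CstarDynsys rcp_conj_hom rcp_conj1 rcp_conjM.

Definition intersection_property : Prop :=
  forall J : set B, cstar_ideal J -> (exists2 x, J x & x != 0) ->
  exists2 a : A, J (rcp_incl B a) & rcp_incl B a != 0.

Definition pseudo_expectation (I : injective_hull A) (phi : B -> I) : Prop :=
  @nds_morphism R G (nds_of_cds rcp_cds) (nds_of_cds I) phi /\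
  forall a : A, phi (rcp_incl B a) = hull_incl I a.

Definition faithful (I : injective_hull A) (phi : B -> I) : Prop :=
  forall x : B, phi (star x * x) = 0 -> x = 0.

End CrossedProducts.

(* Main.v *)
(* Suppose the intersection property holds and phi is a pseudo-expectation. The
   set J of all x with phi(y x z) = 0 for all y, z is a closed ideal meeting A
   trivially, hence J = 0. If phi(x^* x) = 0 then phi(y x) = 0 for all y by the
   Cauchy-Schwarz inequality; since A lies in the multiplicative domain of phi
   and phi is equivariant, phi(y x a lambda_s) = 0 as well, so x is in J.

   Conversely, let J be a nonzero ideal with A meeting J trivially. On the
   operator system A + J the map a + j |-> a is equivariant, and it is completely
   positive: if X + K >= 0 with X in M_n(A) and K in M_n(J), conjugation by the
   negative part X_- gives 0 <= X_-^3 <= X_- K X_-, and closed ideals are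
   hereditary, so X_-^3 is in M_n(J) and M_n(A), hence is 0. By injectivity of
   the hull the map extends to a pseudo-expectation, which kills J. *)
From HB Require Import structures.
Require Import Defs.
From mathcomp Require Import all_boot all_order all_algebra.
From mathcomp Require Import finmap complex.
From mathcomp Require Import all_classical all_reals all_analysis.
From mathcomp Require Import ring lra.
Import Order.TTheory GRing.Theory Num.Theory.
Import numFieldNormedType.Exports.

Set Implicit Arguments.
Unset Strict Implicit.
Unset Printing Implicit Defensive.

Local Open Scope classical_set_scope.
Local Open Scope ring_scope.
Local Open Scope complex_scope.


(* A C*-algebra structure on a ring. The scalars act through a central copy
   [rs] of the reals and a central imaginary unit [im], because in MathComp the
   scalars of ['M[A]_n] are the elements of [A] and not those of [R[i]]. *)
Record cstar_axioms (R : realType) (V : pzRingType) (rs : {rmorphism R -> V})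
    (im : V) (st : V -> V) (nrm : V -> R) : Prop := CstarAxioms {
  ca_rsC : forall c x, rs c * x = x * rs c;
  ca_imC : forall x, im * x = x * im;
  ca_imM : im * im = -1;
  ca_st_rs : forall c, st (rs c) = rs c;
  ca_st_im : st im = - im;
  ca_stK : involutive st;
  ca_stD : {morph st : x y / x + y};
  ca_stM : forall x y, st (x * y) = st y * st x;
  ca_nrm_ge0 : forall x, 0 <= nrm x;
  ca_nrm0_eq0 : forall x, nrm x = 0 -> x = 0;
  ca_nrmD : forall x y, nrm (x + y) <= nrm x + nrm y;
  ca_nrmZ : forall c x, nrm (rs c * x) <= `|c| * nrm x;
  ca_nrmM : forall x y, nrm (x * y) <= nrm x * nrm y;
  ca_nrm_st : forall x, nrm x ^+ 2 <= nrm (st x * x);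
  ca_complete : forall u : nat -> V,
    (forall e, 0 < e -> exists N, forall m n, (N <= m)%N -> (N <= n)%N ->
       nrm (u m - u n) < e) ->
    exists l, forall e, 0 < e -> exists N, forall n, (N <= n)%N ->
      nrm (u n - l) < e
}.

(** * Positivity in C*-algebras without spectral theory *)

Section CstarTheory.
Context (R : realType) (V : pzRingType) (rs : {rmorphism R -> V}).
Context (im : V) (st : V -> V) (nrm : V -> R).
Hypothesis ca : cstar_axioms rs im st nrm.

Let rsC := ca_rsC ca.
Let imC := ca_imC ca.
Let imM := ca_imM ca.
Let st_rs := ca_st_rs ca.
Let stK := ca_stK ca.
Let stD := ca_stD ca.
Let stM := ca_stM ca.
Let nrm_ge0 := ca_nrm_ge0 ca.
Let nrm0_eq0 := ca_nrm0_eq0 ca.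
Let nrmD := ca_nrmD ca.
Let nrmZ := ca_nrmZ ca.
Let nrmM := ca_nrmM ca.

Local Notation comm := GRing.comm.

Lemma ca_st0 : st 0 = 0.
Proof. by apply: (addrI (st 0)); rewrite -stD !addr0. Qed.

Lemma ca_stN x : st (- x) = - st x.
Proof. by apply/eqP; rewrite -addr_eq0 -stD addNr ca_st0. Qed.

Lemma ca_stB x y : st (x - y) = st x - st y.
Proof. by rewrite stD ca_stN. Qed.

Lemma ca_st1 : st 1 = 1.
Proof. by rewrite -(rmorph1 rs) st_rs. Qed.

Lemma ca_nrm0 : nrm 0 = 0.
Proof.
apply/eqP; rewrite eq_le nrm_ge0 andbT.
by have := nrmZ 0 0; rewrite mulr0 normr0 mul0r.
Qed.

Lemma ca_nrmN x : nrm (- x) = nrm x.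
Proof.
have le y : nrm (- y) <= nrm y.
  by have := nrmZ (-1) y; rewrite rmorphN1 mulN1r normrN1 mul1r.
by apply/eqP; rewrite eq_le le -{1}[x]opprK le.
Qed.

Lemma ca_distC x y : nrm (x - y) = nrm (y - x).
Proof. by rewrite -ca_nrmN opprB. Qed.

Lemma ca_nrmB x y : nrm (x - y) <= nrm x + nrm y.
Proof. by rewrite -(ca_nrmN y). Qed.

Lemma ca_nrm_tri y x z : nrm (x - z) <= nrm (x - y) + nrm (y - z).
Proof. by have := nrmD (x - y) (y - z); rewrite addrA subrK. Qed.

Lemma ca_nrm_stE x : nrm (st x) = nrm x.
Proof.
have le y : nrm y <= nrm (st y).
  have := le_trans (ca_nrm_st ca y) (nrmM _ _); rewrite expr2.
  have [->|y0] := eqVneq (nrm y) 0; first by rewrite nrm_ge0.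
  by rewrite ler_pM2r // lt_def y0 nrm_ge0.
by apply/eqP; rewrite eq_le le -{2}[x]stK le.
Qed.

Lemma ca_nrm_sq x : nrm (st x * x) = nrm x ^+ 2.
Proof.
apply/eqP; rewrite eq_le (ca_nrm_st ca) andbT.
by apply: le_trans (nrmM _ _) _; rewrite ca_nrm_stE expr2.
Qed.

(** The C*-identity at 1 gives [nrm 1 = nrm 1 ^+ 2]. Only an inequality is claimed because [nrm 1]
    is 0 in the zero algebra. *)
Lemma ca_nrm1 : nrm 1 <= 1.
Proof.
have := ca_nrm_sq 1; rewrite ca_st1 mulr1 expr2.
have [->|n0] := eqVneq (nrm 1) 0; first by rewrite ler01.
by rewrite -{1}[nrm 1]mulr1 => /(mulfI n0) <-.
Qed.

Lemma ca_nrm_rs c : nrm (rs c) <= `|c|.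
Proof.
rewrite -[rs c]mulr1; apply: le_trans (nrmZ _ _) _.
by rewrite -[leRHS]mulr1 ler_wpM2l // ca_nrm1.
Qed.

Lemma ca_nrmZE c x : nrm (rs c * x) = `|c| * nrm x.
Proof.
have [->|c0] := eqVneq c 0.
  by rewrite rmorph0 mul0r ca_nrm0 normr0 mul0r.
apply/eqP; rewrite eq_le nrmZ /=.
have := nrmZ c^-1 (rs c * x).
by rewrite mulrA -rmorphM mulVf // rmorph1 mul1r normfV ler_pdivlMl ?normr_gt0.
Qed.

Lemma rs_half x : rs 2^-1 * (x + x) = x.
Proof.
rewrite -mulr2n mulrnAr -mulrnAl -rmorphMn /= -mulr_natr.
by rewrite mulVf ?pnatr_eq0 // rmorph1 mul1r.
Qed.

Lemma ca_comm_rs c x : comm x (rs c).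
Proof. exact/esym/rsC. Qed.

Lemma rs_mulACA a b x y : rs a * x * (rs b * y) = rs (a * b) * (x * y).
Proof. by rewrite rmorphM -mulrA (mulrA x) -(rsC b x) !mulrA. Qed.

(** * Limits of iterations: square roots and inverses *)

Definition ca_cvg (u : nat -> V) l :=
  forall e, 0 < e -> exists N, forall n, (N <= n)%N -> nrm (u n - l) < e.

(** The increments of [r] dominate norms, so [r] is nondecreasing; being bounded it is Cauchy, and
    [u] inherits this by telescoping. *)
Lemma ca_cvg_majorant u (r : nat -> R) M :
  (forall n, nrm (u n.+1 - u n) <= r n.+1 - r n) -> (forall n, r n <= M) ->
  exists l, ca_cvg u l.
Proof.
move=> ur rM; apply: (ca_complete ca) => e e0.
have ndr n m : (n <= m)%N -> r n <= r m.
  move=> /subnKC <-; elim: (m - n)%N => [|k]; rewrite ?addn0 // addnS.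
  by move/le_trans; apply; have := le_trans (nrm_ge0 _) (ur (n + k)%N); lra.
have hs : has_sup (range r).
  by split; [exists (r 0%N), 0%N | exists M => _ [n _ <-]].
have [_ [N _ <-] hN] := sup_adherent e0 hs.
have up n : r n <= sup (range r) by apply: (ub_le_sup hs.2); exists n.
have le m n : (n <= m)%N -> nrm (u m - u n) <= r m - r n.
  move=> /subnKC <-; elim: (m - n)%N => [|k]; rewrite ?addn0 ?subrr ?ca_nrm0 //.
  rewrite addnS => IH; apply: le_trans (ca_nrm_tri (u (n + k)%N) _ _) _.
  by have := ur (n + k)%N; lra.
have lt m n : (N <= n)%N -> (n <= m)%N -> nrm (u m - u n) < e.
  move=> Nn nm; apply: le_lt_trans (le _ _ nm) _.
  by have := up m; have := ndr _ _ Nn; lra.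
exists N => m n Nm Nn; have [nm|/ltnW mn] := leqP n m; first exact: lt.
by rewrite ca_distC; apply: lt.
Qed.

(** The form in which identities pass to a limit. Two consecutive iterates appear because a
    fixed-point equation compares [u n] with its successor. *)
Lemma ca_cvg_eq0 u l z C : ca_cvg u l -> 0 <= C ->
  (forall n, nrm z <= C * (nrm (u n - l) + nrm (u n.+1 - l))) -> z = 0.
Proof.
move=> ul C0 hz; apply: nrm0_eq0; apply/eqP; rewrite eq_le nrm_ge0 andbT.
apply/ler_addgt0Pr => e e0; rewrite add0r.
have C1 : 0 < 2 * (C + 1) by lra.
have e'0 : 0 < e / (2 * (C + 1)) by rewrite divr_gt0.
have [N hN] := ul _ e'0.
have := hN N (leqnn N); have := hN N.+1 (leqnSn N).
rewrite !ltr_pdivlMr // => l2 l1; apply: le_trans (hz N) _.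
have := nrm_ge0 (u N - l); have := nrm_ge0 (u N.+1 - l); nra.
Qed.

(* [s = 1 - l], where [l] is the limit of [x |-> (1 - h + x^2) / 2] iterated from
   0; the iterates are dominated by the real ones for [h = 0]. *)
Lemma ca_sqrt1 h : st h = h -> nrm (1 - h) <= 1 ->
  exists s, [/\ st s = s, s * s = h, nrm (1 - s) <= 1 &
                forall z, comm z h -> comm z s].
Proof.
move=> hh h1; pose y : V := 1 - h.
pose F (x : V) : V := rs 2^-1 * (y + x * x).
pose u n : V := iter n F 0.
pose r n := iter n (fun t : R => 2^-1 * (1 + t ^+ 2)) 0.
have uS n : u n.+1 = F (u n) by [].
have rS n : r n.+1 = 2^-1 * (1 + r n ^+ 2) by [].
have r01 n : 0 <= r n <= 1.
  elim: n => [|n /andP[r0 r1]]; first by rewrite lexx ler01.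
  by rewrite rS; apply/andP; split; nra.
have half0 : `|2^-1 : R| = 2^-1 by rewrite gtr0_norm ?invr_gt0.
have ur n : nrm (u n) <= r n.
  elim: n => [|n IH]; first by rewrite ca_nrm0.
  rewrite uS rS; apply: le_trans (nrmZ _ _) _; rewrite half0.
  rewrite ler_pM2l ?invr_gt0 //; apply: le_trans (nrmD _ _) _.
  apply: lerD => //; apply: le_trans (nrmM _ _) _.
  by rewrite expr2; apply: ler_pM.
(* The difference of squares is split as x (x - x') + (x - x') x', which holds without
   commutativity. *)
have FB (x x' : V) : nrm (F x - F x') <= 2^-1 * (nrm x + nrm x') * nrm (x - x').
  have -> : F x - F x' = rs 2^-1 * (x * (x - x') + (x - x') * x').
    rewrite /F -mulrBr; congr (_ * _).
    by rewrite opprD addrACA subrr add0r mulrBr mulrBl addrA subrK.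
  apply: le_trans (nrmZ _ _) _; rewrite half0 -mulrA ler_pM2l ?invr_gt0 //.
  apply: le_trans (nrmD _ _) _; rewrite [leRHS]mulrDl.
  by apply: lerD; rewrite // [leRHS]mulrC.
have du n : nrm (u n.+1 - u n) <= r n.+1 - r n.
  elim: n => [|n IH].
    rewrite !rS /r /u /= subr0 /F mulr0 addr0; apply: le_trans (nrmZ _ _) _.
    by rewrite half0 expr0n addr0 subr0 ler_pM2l ?invr_gt0.
  rewrite (uS n.+1) {2}(uS n); apply: le_trans (FB _ _) _.
  have -> : r n.+2 - r n.+1 = 2^-1 * (r n.+1 + r n) * (r n.+1 - r n).
    by rewrite (rS n.+1) {2}(rS n); ring.
  apply: ler_pM => //; last by rewrite ler_pM2l ?invr_gt0 // lerD.
  by rewrite mulr_ge0 ?invr_ge0 // addr_ge0.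
have [l ul] := ca_cvg_majorant du (fun n => proj2 (andP (r01 n))).
have l1 : nrm l <= 1.
  apply/ler_addgt0Pr => e /ul [N hN]; have := hN N (leqnn N).
  have := ca_nrm_tri (u N) l 0; rewrite !subr0 ca_distC.
  by have := ur N; have /andP[_] := r01 N; lra.
have u1 n : nrm (u n) <= 1.
  by have /andP[_] := r01 n; have := ur n; apply: le_trans.
have Fl : F l = l.
  apply/eqP; rewrite -subr_eq0; apply/eqP; apply: (ca_cvg_eq0 ul ler01) => n.
  rewrite mul1r; apply: le_trans (ca_nrm_tri (u n.+1) _ _) _; rewrite lerD2r uS.
  rewrite ca_distC; apply: le_trans (FB _ _) _; rewrite -[leRHS]mul1r.
  by apply: ler_wpM2r => //; have := u1 n; lra.
(* As h = 1 - y, the fixed-point equation 2 l = y + l^2 says exactly that (1 - l)^2 = h. *)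
have hl : l + l = y + l * l by rewrite -{1 2}Fl /F -mulrDr rs_half.
exists (1 - l); split.
- rewrite ca_stB ca_st1; congr (_ - _); apply/eqP; rewrite -subr_eq0; apply/eqP.
  have su n : st (u n) = u n.
    elim: n => [|n IH]; first exact: ca_st0.
    by rewrite uS /F stM st_rs stD stM IH /y ca_stB ca_st1 hh rsC.
  apply: (@ca_cvg_eq0 u l _ 2) => // n.
  apply: le_trans (ca_nrm_tri (u n) _ _) _; rewrite -{1}(su n) -ca_stB.
  rewrite ca_nrm_stE ca_distC.
  by have := nrm_ge0 (u n.+1 - l); lra.
- rewrite mulrBl mul1r mulrBr mulr1 opprB.
  have -> : 1 - l + (l * l - l) = 1 - (l + l) + l * l.
    by rewrite opprD !addrA [LHS](ACl (1*2*4*3))%AC.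
  by rewrite hl opprD addrA subrK /y opprB addrCA subrr addr0.
- by rewrite opprB addrCA subrr addr0.
- move=> z zh; apply: commrB; first exact: commr1.
  have zu n : comm z (u n).
    elim: n => [|n IH]; first exact: commr0.
    apply: commrM; first exact: ca_comm_rs.
    apply: commrD; last exact: commrM.
    by apply: commrB => //; exact: commr1.
  apply/eqP; rewrite -subr_eq0; apply/eqP.
  apply: (@ca_cvg_eq0 u l _ (nrm z + nrm z)) => // [|n]; first exact: addr_ge0.
  (* Since [z] commutes with [u n], its commutator with [l] is its commutator with [l - u n], which
     is small. *)
  have -> : z * l - l * z = (u n - l) * z - z * (u n - l).
    by rewrite mulrBl mulrBr zu opprB [RHS]addrC addrA subrK.
  apply: le_trans (ca_nrmB _ _) _.
  have := nrm_ge0 (u n.+1 - l); have := nrm_ge0 z.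
  have := nrmM z (u n - l); have := nrmM (u n - l) z; nra.
Qed.

(** The inverse is the limit of x |-> 1 + z x iterated from 0, dominated by the partial sums of the
    geometric series of ratio [nrm z]. The commutation clause, applied to [z] itself, makes it
    two-sided. *)
Lemma ca_neumann z : nrm z < 1 ->
  exists g, (1 - z) * g = 1 /\ forall w, comm w z -> comm w g.
Proof.
move=> z1; pose q := nrm z; have q0 : 0 <= q by exact: nrm_ge0.
pose F (x : V) : V := 1 + z * x; pose u n : V := iter n F 0.
pose r n := iter n (fun t : R => 1 + q * t) 0.
have uS n : u n.+1 = F (u n) by [].
have rS n : r n.+1 = 1 + q * r n by [].
have q1 : 0 < 1 - q by rewrite subr_gt0.
have FB (x x' : V) : nrm (F x - F x') <= q * nrm (x - x').
  by rewrite /F opprD addrACA subrr add0r -mulrBr; exact: nrmM.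
have rM n : r n <= (1 - q)^-1.
  rewrite -[leRHS]mul1r ler_pdivlMr //.
  elim: n => [|n IH]; first by rewrite mul0r.
  by rewrite rS; nra.
have du n : nrm (u n.+1 - u n) <= r n.+1 - r n.
  elim: n => [|n IH].
    by rewrite rS /r /u /= subr0 /F !mulr0 !addr0 subr0 ca_nrm1.
  rewrite (uS n.+1) {2}(uS n); apply: le_trans (FB _ _) _.
  have -> : r n.+2 - r n.+1 = q * (r n.+1 - r n).
    by rewrite (rS n.+1) {2}(rS n); ring.
  exact: ler_wpM2l.
have [l ul] := ca_cvg_majorant du rM.
have Fl : F l = l.
  apply/eqP; rewrite -subr_eq0; apply/eqP; apply: (ca_cvg_eq0 ul ler01) => n.
  rewrite mul1r; apply: le_trans (ca_nrm_tri (u n.+1) _ _) _; rewrite lerD2r uS.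
  rewrite ca_distC; apply: le_trans (FB _ _) _; rewrite -[leRHS]mul1r.
  by apply: ler_wpM2r => //; exact: ltW.
exists l; split; first by rewrite mulrBl mul1r -{1}Fl /F addrK.
move=> w wz.
have wu n : comm w (u n).
  elim: n => [|n IH]; first exact: commr0.
  by apply: commrD; [exact: commr1 | exact: commrM].
apply/eqP; rewrite -subr_eq0; apply/eqP.
apply: (@ca_cvg_eq0 u l _ (nrm w + nrm w)) => // [|n]; first exact: addr_ge0.
have -> : w * l - l * w = (u n - l) * w - w * (u n - l).
  by rewrite mulrBl mulrBr wu opprB [RHS]addrC addrA subrK.
apply: le_trans (ca_nrmB _ _) _.
have := nrm_ge0 (u n.+1 - l); have := nrm_ge0 w.
have := nrmM w (u n - l); have := nrmM (u n - l) w; nra.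
Qed.

(* [k] is the real part of [u = k + im w], and [u^* u = c]. *)
Lemma ca_nrm_sumsq k w c : st k = k -> st w = w -> comm k w ->
  k * k + w * w = rs c -> 0 <= c -> nrm k ^+ 2 <= c.
Proof.
move=> kk ww kw kwc c0; pose u : V := k + im * w.
have su : st u = k - im * w.
  by rewrite stD stM kk ww (ca_st_im ca) mulrN -imC.
have uu : st u * u = rs c.
  rewrite su -kwc mulrBl !mulrDr !mulrA -(imC k) -!mulrA kw opprD !addrA.
  by rewrite addrK (mulrA w) -imC -mulrA (mulrA im im) imM mulN1r opprK.
have hu : nrm u ^+ 2 <= c.
  by rewrite -ca_nrm_sq uu; have := ca_nrm_rs c; rewrite ger0_norm.
have kE : k = rs 2^-1 * (u + st u).
  by rewrite su addrACA subrr addr0 rs_half.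
have ku : nrm k <= nrm u.
  rewrite kE; apply: le_trans (nrmZ _ _) _.
  rewrite gtr0_norm ?invr_gt0 // ler_pdivrMl ?ltr0n // mulr_natl mulr2n.
  by apply: le_trans (nrmD _ _) _; rewrite ca_nrm_stE.
by apply: le_trans hu; rewrite !expr2; apply: ler_pM.
Qed.

(** * The positive cone *)

Definition ca_pos h := exists2 k, st k = k & h = k * k.

Lemma ca_pos_sa h : ca_pos h -> st h = h.
Proof. by case=> k kk ->; rewrite stM kk. Qed.

Lemma ca_sa_sq_eq0 k : st k = k -> k * k = 0 -> k = 0.
Proof.
move=> kk k2; apply: nrm0_eq0; apply/eqP; rewrite -sqrf_eq0 -ca_nrm_sq kk k2.
by rewrite ca_nrm0.
Qed.

Lemma ca_pos0 : ca_pos 0.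
Proof. by exists 0; rewrite ?ca_st0 ?mulr0. Qed.

Lemma ca_posZ (c : R) h : 0 <= c -> ca_pos h -> ca_pos (rs c * h).
Proof.
move=> c0 [k kk ->]; exists (rs (Num.sqrt c) * k).
  by rewrite stM kk st_rs rsC.
by rewrite rs_mulACA -(expr2 (Num.sqrt c)) sqr_sqrtr.
Qed.

(** Rescaling of [ca_sqrt1] from radius 1 to radius [c]. The last bound has the shape of the
    hypothesis, so the root is itself positive by [ca_pos_crit]. *)
Lemma ca_sqrt h c : st h = h -> nrm (rs c - h) <= c ->
  exists2 s, [/\ st s = s, s * s = h & nrm (rs (Num.sqrt c) - s) <= Num.sqrt c]
    & forall z, comm z h -> comm z s.
Proof.
move=> hh hc; have c0 : 0 <= c by exact: le_trans hc.
have [c00|cN0] := eqVneq c 0.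
  exists 0; last by move=> z _; exact: commr0.
  rewrite ca_st0 mulr0 c00 sqrtr0 rmorph0 subrr ca_nrm0; split=> //.
  apply/esym/nrm0_eq0/eqP.
  by rewrite eq_le nrm_ge0 andbT -ca_nrmN -[- h]add0r -(rmorph0 rs) -{2}c00 -c00.
have c_gt0 : 0 < c by rewrite lt_def cN0.
have [||s [ss s2 s1 sz]] := @ca_sqrt1 (rs c^-1 * h).
- by rewrite stM st_rs hh rsC.
- rewrite -(rmorph1 rs) -(mulVf cN0) rmorphM -mulrBr.
  apply: le_trans (nrmZ _ _) _.
  by rewrite gtr0_norm ?invr_gt0 // ler_pM2l ?invr_gt0.
exists (rs (Num.sqrt c) * s).
  split; first by rewrite stM st_rs ss rsC.
    rewrite rs_mulACA -(expr2 (Num.sqrt c)) sqr_sqrtr //.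
    by rewrite s2 mulrA -rmorphM mulfV // rmorph1 mul1r.
  rewrite -{1}[rs _]mulr1 -mulrBr; apply: le_trans (nrmZ _ _) _.
  by rewrite ger0_norm ?sqrtr_ge0 // ler_piMr ?sqrtr_ge0.
move=> z zh; apply: commrM; first exact: ca_comm_rs.
by apply: sz; apply: commrM => //; exact: ca_comm_rs.
Qed.

(** A substitute for a spectrum in [0, 2c]. With the converse [ca_pos_nrm], positivity becomes a
    norm condition, and [ca_posD] reduces to the triangle inequality. *)
Lemma ca_pos_crit h c : st h = h -> nrm (rs c - h) <= c -> ca_pos h.
Proof. by move=> hh /(ca_sqrt hh) [s [ss <- _] _]; exists s. Qed.

(** Write h = k^2. Then c - h has a square root w commuting with k, and k^2 + w^2 = c bounds w by
    [ca_nrm_sumsq]. *)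
Lemma ca_pos_nrm h c : ca_pos h -> nrm h <= c -> nrm (rs c - h) <= c.
Proof.
move=> [k kk ->] kc; have c0 := le_trans (nrm_ge0 _) kc.
have hh : st (rs c - k * k) = rs c - k * k by rewrite ca_stB st_rs stM kk.
have [|w [ww w2 _] wk] := ca_sqrt (c := c) hh.
  by rewrite opprB addrCA subrr addr0.
rewrite -w2 -{1}ww ca_nrm_sq; apply: (ca_nrm_sumsq (w := k)) => //.
  apply/commr_sym/wk; apply: commrB; first exact: ca_comm_rs.
  exact: commrM.
by rewrite w2 subrK.
Qed.

Lemma ca_pos_sqrt h : ca_pos h ->
  exists2 s, ca_pos s /\ s * s = h & forall z, comm z h -> comm z s.
Proof.
move=> hp.
have [s [ss s2 s1] sz] := ca_sqrt (ca_pos_sa hp) (ca_pos_nrm hp (lexx _)).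
by exists s => //; split=> //; exact: ca_pos_crit s1.
Qed.

Lemma ca_posD h k : ca_pos h -> ca_pos k -> ca_pos (h + k).
Proof.
move=> hp kp; apply: (@ca_pos_crit _ (nrm h + nrm k)).
  by rewrite stD !ca_pos_sa.
rewrite rmorphD opprD addrACA; apply: le_trans (nrmD _ _) _.
by apply: lerD; apply: ca_pos_nrm.
Qed.

(** Each root commutes with whatever commutes with its square, so the two roots commute and their
    product squares to h k. *)
Lemma ca_posM h k : ca_pos h -> ca_pos k -> comm h k -> ca_pos (h * k).
Proof.
move=> /ca_pos_sqrt [s [/ca_pos_sa ss <-] sz].
move=> /ca_pos_sqrt [r [/ca_pos_sa rr <-] rz] hk.
have sr : comm s r.
  by apply: rz; apply/commr_sym/sz/commr_sym.
exists (s * r); first by rewrite stM ss rr sr.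
by rewrite -!mulrA (mulrA r) -sr !mulrA.
Qed.

(** With commuting roots h = k^2 and -h = w^2, the sum k^2 + w^2 is 0, and [ca_nrm_sumsq] with
    constant 0 kills k. *)
Lemma ca_pos_anti h : ca_pos h -> ca_pos (- h) -> h = 0.
Proof.
move=> [k kk kh] /ca_pos_sqrt [w [/ca_pos_sa ww w2] wz].
have kw : comm k w by apply: wz; rewrite kh; apply/commrN/commrM.
have : nrm k ^+ 2 <= 0.
  by apply: (ca_nrm_sumsq kk ww kw) => //; rewrite -kh w2 subrr rmorph0.
rewrite le_eqVlt ltNge sqr_ge0 orbF sqrf_eq0 => /eqP/nrm0_eq0 k0.
by rewrite kh k0 mulr0.
Qed.

Lemma ca_pos_le h c : ca_pos h -> ca_pos (rs c - h) -> 0 <= c -> nrm h <= c.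
Proof.
move=> [k kk kh] /ca_pos_sqrt [w [/ca_pos_sa ww w2] wz] c0.
have kw : comm k w.
  apply: wz; rewrite kh; apply: commrB; first exact: ca_comm_rs.
  exact: commrM.
rewrite kh -{1}kk ca_nrm_sq; apply: (ca_nrm_sumsq kk ww kw) => //.
by rewrite w2 kh addrC subrK.
Qed.

Lemma ca_sa_le h : st h = h -> ca_pos (rs (nrm h) - h).
Proof.
move=> hh; apply: (@ca_pos_crit _ (nrm h)); first by rewrite ca_stB st_rs hh.
by rewrite opprB addrCA subrr addr0.
Qed.

(** By [ca_pos_nrm], |k| - k has norm at most |k|. Hence 1 + t k, divided by N = 1 + t |k|, is at
    distance less than 1 from 1 whatever the size of t, and the Neumann series applies. *)
Lemma ca_pos_inv t k : 0 <= t -> ca_pos k ->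
  exists g, [/\ (1 + rs t * k) * g = 1, g * (1 + rs t * k) = 1, st g = g &
               forall w, comm w k -> comm w g].
Proof.
move=> t0 kp; pose a : V := 1 + rs t * k; rewrite -/a.
pose N := 1 + t * nrm k.
have tk0 : 0 <= t * nrm k by exact: mulr_ge0.
have N0 : 0 < N by rewrite ltr_pwDl.
have NK : rs N^-1 * rs N = 1 by rewrite -rmorphM mulVf ?gt_eqF // rmorph1.
pose z : V := 1 - rs N^-1 * a.
have zE : z = rs (N^-1 * t) * (rs (nrm k) - k).
  rewrite /z -NK -mulrBr rmorphM -mulrA; congr (_ * _).
  by rewrite /a /N rmorphD rmorph1 opprD addrACA subrr add0r mulrBr rmorphM.
have z1 : nrm z < 1.
  rewrite zE; apply: le_lt_trans (nrmZ _ _) _.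
  rewrite ger0_norm ?mulr_ge0 ?invr_ge0 ?(ltW N0) // -mulrA ltr_pdivrMl // mulr1.
  apply: (@le_lt_trans _ _ (t * nrm k)); last by rewrite ltrDr.
  by apply: ler_wpM2l => //; exact: ca_pos_nrm.
have [l [zl lw]] := ca_neumann z1.
pose g := rs N^-1 * l.
have ag : a * g = 1.
  by rewrite /g mulrA -(rsC _ a) -[RHS]zl /z opprB addrCA subrr addr0.
have gw w : comm w k -> comm w g.
  move=> wk; apply: commrM; first exact: ca_comm_rs.
  apply: lw; rewrite zE; apply: commrM; first exact: ca_comm_rs.
  by apply: commrB => //; exact: ca_comm_rs.
have ga : g * a = 1.
  rewrite -[RHS]ag; apply/commr_sym/commr_sym/esym; apply: gw.
  apply/commr_sym/commrD; first exact: commr1.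
  by apply: commrM => //; exact: ca_comm_rs.
exists g; split=> //.
have sa : st a = a by rewrite stD ca_st1 stM st_rs (ca_pos_sa kp) -rsC.
by rewrite -[st g]mulr1 -ag mulrA -{1}sa -stM ag ca_st1 mul1r.
Qed.

(* [c c^*] is positive, being a sum of two squares minus [c^* c]. Hence
   [1 + t c c^*], and with it [1 + t c^* c], is invertible for every [t >= 0]. For
   [t] the inverse of the norm of [c^* c] this is impossible. *)
Lemma ca_pos_neg_sq c : ca_pos (- (st c * c)) -> c = 0.
Proof.
set p : V := - (st c * c) => pp.
suff p0 : p = 0.
  apply: nrm0_eq0; apply/eqP.
  by rewrite -sqrf_eq0 -ca_nrm_sq -ca_nrmN -/p p0 ca_nrm0.
apply: nrm0_eq0; apply/eqP; apply: contraT => np0.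
have np : 0 < nrm p by rewrite lt_def np0 nrm_ge0.
have qp : ca_pos (c * st c).
  pose a : V := c + st c; pose b : V := im * (c - st c).
  have sa : st a = a by rewrite stD stK addrC.
  have sb : st b = b.
    by rewrite stM ca_stB stK (ca_st_im ca) mulrN -imC -mulrN opprB.
  have -> : c * st c = rs 2^-1 * (a * a + b * b) + p.
    have -> : a * a + b * b = (c * st c + st c * c) + (c * st c + st c * c).
      have -> : b * b = - ((c - st c) * (c - st c)).
        by rewrite /b -mulrA (mulrA _ im) -imC -mulrA mulrA imM mulN1r.
      rewrite mulrBl !mulrBr mulrDl !mulrDr !opprB !addrA.
      by rewrite [LHS](ACl (1*8*4*6*2*3*7*5))%AC /=
        subrr add0r subrr add0r.
    by rewrite rs_half /p addrK.
  apply: ca_posD => //; apply: ca_posZ; first by rewrite invr_ge0.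
  by apply: ca_posD; [exists a | exists b].
pose t := (nrm p)^-1; have t0 : 0 < t by rewrite invr_gt0.
have [g [ag _ sg _]] := ca_pos_inv (ltW t0) qp.
(* As g inverts 1 + t c c^*, the element m = 1 - t c^* g c inverts y = 1 + t c^* c. *)
pose y : V := 1 - rs t * p; pose m : V := 1 - rs t * (st c * g * c).
have ym : y * m = 1.
  have -> : y = 1 + rs t * (st c * c) by rewrite /y /p mulrN opprK.
  rewrite /m mulrBr mulr1 mulrDl mul1r -addrA -[RHS]addr0; congr (_ + _).
  rewrite -(mulrA (rs t) (st c * c)) -mulrDr.
  have -> : st c * g * c + st c * c * (rs t * (st c * g * c)) = st c * c.
    have -> : st c * c * (rs t * (st c * g * c)) =
              st c * (rs t * (c * st c) * g) * c.
      by rewrite !mulrA -(mulrA (st c) c) -(rsC t c) !mulrA.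
    by rewrite -mulrDl -mulrDr -{1}[g]mul1r -mulrDl ag mulr1.
  by rewrite subrr.
have sy : st y = y by rewrite ca_stB ca_st1 stM st_rs ca_pos_sa // -rsC.
have sm : st m = m.
  by rewrite ca_stB ca_st1 !stM st_rs sg stK -rsC /m !mulrA.
have my : m * y = 1 by rewrite -{1}sm -{1}sy -stM ym ca_st1.
have tp1 : nrm (rs t * p) = 1 by rewrite ca_nrmZE gtr0_norm // mulVf.
have yp : ca_pos y.
  apply: (@ca_pos_crit _ 1) => //.
  by rewrite rmorph1 opprB addrCA subrr addr0 tp1.
(* [d] is small enough for 1 - d m to be positive. Multiplication by y makes (1 - d) - t p positive,
   so t p has norm at most 1 - d, although its norm is 1. *)
pose d := (1 + nrm m)^-1.
have m1 : 0 < 1 + nrm m by rewrite ltr_pwDl.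
have d0 : 0 < d by rewrite invr_gt0.
have d1 : d <= 1 by rewrite invf_le1 // lerDl.
have wp : ca_pos (1 - rs d * m).
  apply: (@ca_pos_crit _ 1); first by rewrite ca_stB ca_st1 stM st_rs sm -rsC.
  rewrite rmorph1 opprB addrCA subrr addr0; apply: le_trans (nrmZ _ _) _.
  by rewrite gtr0_norm // ler_pdivrMl // mulr1 lerDr.
have ydp : ca_pos (rs (1 - d) - rs t * p).
  have -> : rs (1 - d) - rs t * p = y * (1 - rs d * m).
    rewrite mulrBr mulr1 mulrA -(rsC d y) -mulrA ym mulr1 rmorphB rmorph1.
    by rewrite addrAC.
  apply: ca_posM => //; apply: commrB; first exact: commr1.
  by apply: commrM; [exact: ca_comm_rs | rewrite /GRing.comm ym my].
have := ca_pos_le (ca_posZ (ltW t0) pp) ydp; rewrite tp1 subr_ge0 => /(_ d1).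
by rewrite lerBrDl gerDr leNgt d0.
Qed.

(* [n] is twice the negative part of [h]. *)
Lemma ca_neg_part h : st h = h ->
  exists n, [/\ st n = n, ca_pos (- (n * h * n)) & n * h * n = 0 -> ca_pos h].
Proof.
move=> hh; have [q [qp q2] qz] := @ca_pos_sqrt (h * h) (ex_intro2 _ _ h hh erefl).
have hq : comm h q by apply: qz; exact: commrM.
have [r [/ca_pos_sa rr r2] rz] := ca_pos_sqrt qp.
have sq := ca_pos_sa qp.
pose n : V := q - h.
have sn : st n = n by rewrite ca_stB hh sq.
have nh : n * h = - (q * n) by rewrite mulrBl mulrBr opprB q2 -hq.
have nq : comm n q by apply/commr_sym/commrB.
have nr : comm n r by exact: rz.
(* Here [q] is the absolute value of [h] and [r] is its root. From q^2 = h^2 comes n h = - q n,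
   hence - n h n = q n^2 = (r n)^2. *)
have nhn : - (n * h * n) = r * n * (r * n).
  by rewrite nh mulNr opprK -r2 -!mulrA; congr (_ * _); rewrite !mulrA nr.
have srn : st (r * n) = r * n by rewrite stM sn rr nr.
exists n; split=> //; first by exists (r * n).
move=> n0; have rn0 : r * n = 0.
  by apply: ca_sa_sq_eq0 => //; rewrite -nhn n0 oppr0.
have qn0 : q * n = 0 by rewrite -r2 -mulrA rn0 mulr0.
have : n = 0.
  apply: ca_sa_sq_eq0 => //; rewrite {1}/n mulrBl qn0 sub0r.
  have -> : h * n = n * h by rewrite /n mulrBl mulrBr hq.
  by rewrite nh qn0 !oppr0.
by move/eqP; rewrite subr_eq0 => /eqP <-.
Qed.

(** Take h = a^* a and n from [ca_neg_part]. Then n h n is the square of the modulus of a n, and its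
    negative is positive, so a n = 0 by [ca_pos_neg_sq]. *)
Theorem ca_pos_star_mul a : ca_pos (st a * a).
Proof.
have hh : st (st a * a) = st a * a by rewrite stM stK.
have [n [sn np nz]] := ca_neg_part hh; apply: nz.
have E : st (a * n) * (a * n) = n * (st a * a) * n by rewrite stM sn !mulrA.
have an0 : a * n = 0 by apply: ca_pos_neg_sq; rewrite E.
by rewrite -E an0 mulr0.
Qed.

(** Squares of self-adjoint elements suit square roots and commutation; this identifies them with
    the form a^* a used by [mxpos]. *)
Lemma ca_pos_starP h : ca_pos h <-> exists a, h = st a * a.
Proof.
split=> [[k kk ->]|[a ->]]; last exact: ca_pos_star_mul.
by exists k; rewrite kk.
Qed.

Lemma ca_pos_conj a p : ca_pos p -> ca_pos (st a * p * a).
Proof.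
case=> k kk ->; have -> : st a * (k * k) * a = st (k * a) * (k * a).
  by rewrite stM kk !mulrA.
exact: ca_pos_star_mul.
Qed.

Lemma ca_pos_sum (I : Type) (s : seq I) (P : pred I) (F : I -> V) :
  (forall i, P i -> ca_pos (F i)) -> ca_pos (\sum_(i <- s | P i) F i).
Proof. by move=> FP; elim/big_ind: _; [exact: ca_pos0 | exact: ca_posD|]. Qed.

Lemma ca_star_mul_eq0 a : st a * a = 0 -> a = 0.
Proof.
move=> a0; apply: nrm0_eq0; apply/eqP; rewrite -sqrf_eq0 -ca_nrm_sq a0.
by rewrite ca_nrm0.
Qed.

(** Each term is positive and equals minus the sum of the others, which are positive too;
    antisymmetry of the cone makes it 0. *)
Lemma ca_sum_star_mul_eq0 (I : finType) (F : I -> V) :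
  \sum_i st (F i) * F i = 0 -> forall i, F i = 0.
Proof.
move=> + i; rewrite (bigD1 i) //= => /eqP; rewrite addr_eq0 => /eqP E.
apply: ca_star_mul_eq0; apply: ca_pos_anti; first exact: ca_pos_star_mul.
by rewrite E opprK; apply: ca_pos_sum => j _; exact: ca_pos_star_mul.
Qed.

Lemma ca_pos_nrm_le a b : ca_pos a -> ca_pos (b - a) -> nrm a <= nrm b.
Proof.
move=> ap bap; have bp : ca_pos b by rewrite -(subrK a b); exact: ca_posD.
apply: ca_pos_le => //.
have -> : rs (nrm b) - a = (rs (nrm b) - b) + (b - a) by rewrite addrA subrK.
by apply: ca_posD => //; apply: ca_sa_le; exact: ca_pos_sa.
Qed.

(* With [g = (1 + t k)^-1]: [4 t k g^2 + ((1 - t k) g)^2 = 1]. *)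
Lemma ca_hereditary k d t : 0 < t -> ca_pos (k - st d * d) ->
  exists g, nrm (d * g) ^+ 2 <= (4 * t)^-1 /\ 1 = g + rs t * k * g.
Proof.
move=> t0 kd.
have kp : ca_pos k.
  by rewrite -(subrK (st d * d) k); apply: ca_posD => //; exact: ca_pos_star_mul.
have [g [ag ga sg gw]] := ca_pos_inv (ltW t0) kp.
exists g; split; last by rewrite -ag mulrDl mul1r.
have t4 : 0 < 4 * t by rewrite mulr_gt0.
rewrite -ca_nrm_sq stM sg.
apply: ca_pos_le; last by rewrite invr_ge0 ltW.
  have -> : g * st d * (d * g) = st (d * g) * (d * g) by rewrite stM sg.
  exact: ca_pos_star_mul.
have -> : rs (4 * t)^-1 - g * st d * (d * g) =
   (rs (4 * t)^-1 - g * k * g) + st g * (k - st d * d) * g.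
  by rewrite sg mulrBr mulrBl !mulrA addrA subrK.
apply: ca_posD; last exact: ca_pos_conj.
pose b : V := (1 - rs t * k) * g.
have kg : comm k g by exact: gw.
have sb : st b = b.
  rewrite stM sg ca_stB ca_st1 stM st_rs (ca_pos_sa kp) -rsC /b.
  by rewrite mulrBl mulrBr mul1r mulr1 mulrA -(rsC t g) -!mulrA kg.
have -> : rs (4 * t)^-1 - g * k * g = rs (4 * t)^-1 * (b * b).
  (* Since g + x = 1 and x commutes with g, b^2 = (g - x)^2 = 1 - 4 x g, while g k g = x g / t. *)
  pose x : V := rs t * k * g.
  have gx : g + x = 1 by rewrite -ag mulrDl mul1r.
  have xg : x * g = g * x.
    by rewrite -[x](addKr g) gx mulrDl mulrDr mul1r mulr1 mulNr mulrN.
  have bE : b = g - x by rewrite /b mulrBl mul1r.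
  have -> : b * b = 1 - rs 4 * (x * g).
    have -> : rs 4 * (x * g) = x * g + x * g + (x * g + x * g).
      by rewrite rmorph_nat mulr_natl -!mulr2n -mulrnA.
    rewrite -[X in X - _]mulr1 -{1 2}gx bE mulrBl !mulrBr !mulrDl !mulrDr -xg.
    rewrite opprB !opprD !addrA [LHS](ACl (1*3*2*4))%AC /=.
    by rewrite [RHS](ACl (1*2*5*3*6*4*7*8))%AC /= !addrK.
  have -> : g * k * g = rs t^-1 * (x * g).
    by rewrite /x !mulrA -rmorphM mulVf ?gt_eqF // rmorph1 mul1r -kg.
  rewrite mulrBr mulr1 (mulrA _ (rs 4)) -rmorphM; congr (_ - rs _ * _).
  by rewrite invfM mulrAC mulVf ?mul1r ?pnatr_eq0.
by apply: ca_posZ; [rewrite invr_ge0 ltW | exists b].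
Qed.

End CstarTheory.


(** * Matrices over a C*-algebra *)

(* [M_n(V)] is a C*-algebra for its norm as an algebra of operators on the
   Hilbert [V]-module [V^n]. *)
Section MatrixCstar.
Context (R : realType) (V : pzRingType) (rs : {rmorphism R -> V}).
Context (im : V) (st : V -> V) (nrm : V -> R).
Hypothesis ca : cstar_axioms rs im st nrm.
Context (n : nat).

Let nrm_ge0 := ca_nrm_ge0 ca.
Let stD := ca_stD ca.
Let stM := ca_stM ca.
Let stK := ca_stK ca.
Local Notation pos := (ca_pos st).
Implicit Types (u v w : 'cV[V]_n) (X Y : 'M[V]_n).

Lemma st_sum (I : Type) (r : seq I) (P : pred I) (F : I -> V) :
  st (\sum_(i <- r | P i) F i) = \sum_(i <- r | P i) st (F i).
Proof. exact: (big_morph st stD (ca_st0 ca)). Qed.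

Lemma nrm_sum (I : Type) (r : seq I) (P : pred I) (F : I -> V) :
  nrm (\sum_(i <- r | P i) F i) <= \sum_(i <- r | P i) nrm (F i).
Proof.
elim/big_rec2: _ => [|i x y _ yx]; first by rewrite (ca_nrm0 ca).
by apply: le_trans (ca_nrmD ca _ _) _; rewrite lerD2l.
Qed.

Definition ip u v : V := \sum_i st (u i 0) * v i 0.

Lemma st_ip u v : st (ip u v) = ip v u.
Proof. by rewrite st_sum; apply: eq_bigr => i _; rewrite stM stK. Qed.

Lemma ipDr u v w : ip u (v + w) = ip u v + ip u w.
Proof. by rewrite -big_split; apply: eq_bigr => i _; rewrite mxE mulrDr. Qed.

Lemma ipDl u v w : ip (u + v) w = ip u w + ip v w.
Proof. by rewrite -st_ip ipDr stD !st_ip. Qed.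

Lemma ipNr u v : ip u (- v) = - ip u v.
Proof. by rewrite -sumrN; apply: eq_bigr => i _; rewrite mxE mulrN. Qed.

Lemma ipNl u v : ip (- u) v = - ip u v.
Proof. by rewrite -st_ip ipNr (ca_stN ca) st_ip. Qed.

(** The module structure is on the right, so that matrices acting from the left are module maps;
    [*:] on columns multiplies on the left. *)
Definition rscale v (a : V) : 'cV[V]_n := \col_i (v i 0 * a).

Lemma ip_rscaler u v a : ip u (rscale v a) = ip u v * a.
Proof. by rewrite mulr_suml; apply: eq_bigr => i _; rewrite mxE mulrA. Qed.

Lemma ip_rscalel u v a : ip (rscale u a) v = st a * ip u v.
Proof. by rewrite -st_ip ip_rscaler stM st_ip. Qed.

Definition mst X : 'M[V]_n := map_mx st X^T.

Lemma ip_mulmx u X v : ip u (X *m v) = ip (mst X *m u) v.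
Proof.
rewrite /ip.
under eq_bigr => i _ do rewrite mxE mulr_sumr.
rewrite exchange_big /=; apply: eq_bigr => j _.
rewrite mxE st_sum mulr_suml; apply: eq_bigr => i _.
by rewrite !mxE stM stK mulrA.
Qed.

Lemma ip_pos v : pos (ip v v).
Proof. by apply: (ca_pos_sum ca) => i _; exact: (ca_pos_star_mul ca). Qed.

Lemma ip_CS u v : nrm (ip u v) ^+ 2 <= nrm (ip u u) * nrm (ip v v).
Proof.
set a := ip u v; set t := nrm (ip u u).
have t0 : 0 <= t by exact: nrm_ge0.
have [tz|tN0] := eqVneq t 0.
  have u0 : ip u u = 0 by exact: (ca_nrm0_eq0 ca).
  have ui0 i : u i 0 = 0 by apply: (ca_sum_star_mul_eq0 ca u0).
  have -> : a = 0.
    by rewrite /a /ip big1 // => i _; rewrite ui0 (ca_st0 ca) mul0r.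
  by rewrite (ca_nrm0 ca) tz mul0r expr0n.
have t1 : 0 < t by rewrite lt_def tN0.
(* Positivity of <w,w>, combined with a^* <u,u> a <= t a^* a, gives t a^* a <= t^2 <v,v>; the claim
   follows on taking norms and cancelling t. *)
pose w := rscale u a - rscale v (rs t).
have wE : ip w w = st a * ip u u * a - rs t * (st a * a) - rs t * (st a * a)
                   + rs (t ^+ 2) * ip v v.
  rewrite ipDr ipNr !ipDl !ipNl !ip_rscaler !ip_rscalel -(st_ip u v) -/a.
  rewrite (ca_st_rs ca) -!(ca_rsC ca) !mulrA expr2 rmorphM opprB addrA.
  by rewrite addrAC.
have p1 : pos (st a * (rs t - ip u u) * a).
  apply: (ca_pos_conj ca); apply: (ca_sa_le ca).
  exact: (ca_pos_sa ca (ip_pos u)).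
have := ca_posD ca p1 (ip_pos w).
have -> : st a * (rs t - ip u u) * a + ip w w =
          rs (t ^+ 2) * ip v v - rs t * (st a * a).
  rewrite wE mulrBr mulrBl -(ca_rsC ca) -!mulrA !addrA subrK subrr add0r addrC.
  by [].
move/(ca_pos_nrm_le ca (ca_posZ ca t0 (ca_pos_star_mul ca a))).
rewrite !(ca_nrmZE ca) (ca_nrm_sq ca) !ger0_norm ?sqr_ge0 //.
by rewrite expr2 -mulrA ler_pM2l.
Qed.

Definition vn v := Num.sqrt (nrm (ip v v)).

Lemma vn_ge0 v : 0 <= vn v. Proof. exact: sqrtr_ge0. Qed.

Lemma vn_sq v : vn v ^+ 2 = nrm (ip v v).
Proof. by rewrite sqr_sqrtr. Qed.

Lemma nrm_ip u v : nrm (ip u v) <= vn u * vn v.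
Proof.
rewrite -(@ler_pXn2r _ 2) ?nnegrE ?mulr_ge0 ?vn_ge0 //.
by rewrite exprMn !vn_sq ip_CS.
Qed.

Lemma vnD u v : vn (u + v) <= vn u + vn v.
Proof.
rewrite -(@ler_pXn2r _ 2) ?nnegrE ?addr_ge0 ?vn_ge0 // vn_sq ipDr !ipDl.
apply: le_trans (ca_nrmD ca _ _) _.
have h1 := ca_nrmD ca (ip u u) (ip v u); have h2 := ca_nrmD ca (ip u v) (ip v v).
have := nrm_ip u v; have := nrm_ip v u; rewrite -!vn_sq in h1 h2; nra.
Qed.

Lemma vnZ (c : R) v : vn ((rs c)%:M *m v) = `|c| * vn v.
Proof.
rewrite /vn -sqrtr_sqr -sqrtrM ?sqr_ge0 //; congr Num.sqrt.
have -> : ip ((rs c)%:M *m v) ((rs c)%:M *m v) = rs (c ^+ 2) * ip v v.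
  rewrite /ip mulr_sumr; apply: eq_bigr => i _.
  rewrite mul_scalar_mx mxE stM (ca_st_rs ca) -(ca_rsC ca) (rs_mulACA ca).
  by rewrite expr2.
by rewrite (ca_nrmZE ca) ger0_norm ?sqr_ge0.
Qed.

Lemma nrm_entry v i : nrm (v i 0) <= vn v.
Proof.
rewrite -(@ler_pXn2r _ 2) ?nnegrE ?vn_ge0 // vn_sq -(ca_nrm_sq ca).
apply: (ca_pos_nrm_le ca); first exact: (ca_pos_star_mul ca).
rewrite /ip (bigD1 i) //= addrAC subrr add0r.
by apply: (ca_pos_sum ca) => j _; exact: (ca_pos_star_mul ca).
Qed.

Lemma vn_le v : vn v <= \sum_i nrm (v i 0).
Proof.
have s0 : 0 <= \sum_i nrm (v i 0) by apply: sumr_ge0.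
rewrite -(@ler_pXn2r _ 2) ?nnegrE ?vn_ge0 // vn_sq.
apply: le_trans (nrm_sum _ _ _) _; rewrite expr2 mulr_suml.
apply: ler_sum => i _; rewrite (ca_nrm_sq ca) expr2 ler_wpM2l //.
by rewrite (bigD1 i) //= lerDl sumr_ge0.
Qed.

Definition mx_opnorm X := sup [set vn (X *m v) | v in [set v | vn v <= 1]].

(** This bound makes the supremum in [mx_opnorm] finite and, through [opnorm_crude], turns entrywise
    limits into norm limits. *)
Lemma vn_mul_crude X v : vn (X *m v) <= (\sum_i \sum_j nrm (X i j)) * vn v.
Proof.
apply: le_trans (vn_le _) _; rewrite mulr_suml; apply: ler_sum => i _.
rewrite mxE; apply: le_trans (nrm_sum _ _ _) _; rewrite mulr_suml.
apply: ler_sum => j _; apply: le_trans (ca_nrmM ca _ _) _.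
by rewrite ler_wpM2l // nrm_entry.
Qed.

Lemma vn0 : vn 0 = 0.
Proof.
by rewrite /vn /ip big1 ?(ca_nrm0 ca) ?sqrtr0 // => i _; rewrite mxE mulr0.
Qed.

Let crude_ge0 X : 0 <= \sum_i \sum_j nrm (X i j).
Proof. by apply: sumr_ge0 => i _; apply: sumr_ge0. Qed.

Lemma opnorm_has_sup X :
  has_sup [set vn (X *m v) | v in [set v | vn v <= 1]].
Proof.
split; first by exists (vn (X *m 0)), 0 => //=; rewrite vn0 ler01.
exists (\sum_i \sum_j nrm (X i j)) => _ [v /= v1 <-].
apply: le_trans (vn_mul_crude _ _) _.
by rewrite -[leRHS]mulr1 ler_wpM2l.
Qed.

Lemma opnorm_le X c : (forall v, vn v <= 1 -> vn (X *m v) <= c) ->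
  mx_opnorm X <= c.
Proof.
move=> h; apply: ge_sup; first exact: (opnorm_has_sup X).1.
by move=> _ [v /= /h + <-].
Qed.

Lemma opnorm_ub X v : vn v <= 1 -> vn (X *m v) <= mx_opnorm X.
Proof. by move=> v1; apply: (ub_le_sup (opnorm_has_sup X).2); exists v. Qed.

Lemma opnorm_ge0 X : 0 <= mx_opnorm X.
Proof.
by apply: le_trans (vn_ge0 _) (opnorm_ub X (v := 0) _); rewrite vn0 ler01.
Qed.

Lemma vn_mulmx X v : vn (X *m v) <= mx_opnorm X * vn v.
Proof.
have [v0|vN0] := eqVneq (vn v) 0.
  by have := vn_mul_crude X v; rewrite v0 !mulr0.
have v_gt0 : 0 < vn v by rewrite lt_def vN0 vn_ge0.
have := @opnorm_ub X ((rs (vn v)^-1)%:M *m v).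
rewrite vnZ ger0_norm ?invr_ge0 ?vn_ge0 // mulVf // => /(_ (lexx _)).
have -> : X *m ((rs (vn v)^-1)%:M *m v) = (rs (vn v)^-1)%:M *m (X *m v).
  rewrite !mulmxA; congr (_ *m v).
  apply/matrixP => i j; rewrite mul_scalar_mx mxE mxE (bigD1 j) //=.
  rewrite big1 ?addr0 ?mxE ?eqxx ?mulr1n -?(ca_rsC ca) // => k kj.
  by rewrite mxE (negPf kj) mulr0.
by rewrite vnZ ger0_norm ?invr_ge0 ?vn_ge0 // ler_pdivrMl // mulrC.
Qed.

Lemma opnorm_crude X : mx_opnorm X <= \sum_i \sum_j nrm (X i j).
Proof.
apply: opnorm_le => v v1; apply: le_trans (vn_mul_crude _ _) _.
by rewrite -[leRHS]mulr1 ler_wpM2l.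
Qed.

Lemma nrm_opnorm X i j : nrm (X i j) <= mx_opnorm X.
Proof.
have XE : X i j = (X *m delta_mx j (0 : 'I_1)) i 0 by rewrite -colE mxE.
rewrite XE; apply: le_trans (nrm_entry _ _) _; apply: opnorm_ub.
rewrite -(@ler_pXn2r _ 2) ?nnegrE ?vn_ge0 ?ler01 // vn_sq expr1n.
rewrite /ip (bigD1 j) //= big1 ?addr0 => [|k kj].
  by rewrite mxE !eqxx mulr1 (ca_st1 ca) (ca_nrm1 ca).
by rewrite mxE (negPf kj) mulr0.
Qed.

Lemma mstM X Y : mst (X *m Y) = mst Y *m mst X.
Proof.
apply/matrixP => i j; rewrite !mxE st_sum; apply: eq_bigr => k _.
by rewrite !mxE stM.
Qed.

(** Through [ca_pos_starP], this makes [mxpos] the positive cone studied above, now for M_n. *)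
Lemma mx_cstar_axioms :
  cstar_axioms (scalar_mx \o rs : {rmorphism R -> 'M[V]_n}) im%:M mst mx_opnorm.
Proof.
have sC (a : V) X : (forall x, a * x = x * a) -> a%:M *m X = X *m a%:M.
  move=> aC; apply/matrixP => i j; rewrite mul_scalar_mx mxE mxE (bigD1 j) //=.
  by rewrite big1 ?addr0 ?mxE ?eqxx // => k kj; rewrite mxE (negPf kj) mulr0.
have st_scalar (a : V) : mst a%:M = (st a)%:M.
  apply/matrixP => i j; rewrite !mxE eq_sym.
  by case: eqP => _; rewrite ?mulr1n ?mulr0n ?(ca_st0 ca).
have ge0 := opnorm_ge0.
split=> //=.
- by move=> c X; apply: sC; exact: (ca_rsC ca).
- by move=> X; apply: sC; exact: (ca_imC ca).
- by rewrite -mulmxE -scalar_mxM (ca_imM ca) rmorphN1.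
- by move=> c; rewrite st_scalar (ca_st_rs ca).
- by rewrite st_scalar (ca_st_im ca) rmorphN.
- by move=> X; apply/matrixP => i j; rewrite !mxE stK.
- by move=> X Y; apply/matrixP => i j; rewrite !mxE stD.
- exact: mstM.
- move=> X X0; apply/matrixP => i j; rewrite mxE; apply: (ca_nrm0_eq0 ca).
  by apply/eqP; rewrite eq_le nrm_ge0 andbT -X0 nrm_opnorm.
- move=> X Y; apply: opnorm_le => v v1; rewrite mulmxDl.
  by apply: le_trans (vnD _ _) _; apply: lerD; exact: opnorm_ub.
- move=> c X; apply: opnorm_le => v v1; rewrite -mulmxE -mulmxA vnZ.
  by rewrite ler_wpM2l // opnorm_ub.
- move=> X Y; apply: opnorm_le => v v1; rewrite -mulmxE -mulmxA.
  apply: le_trans (vn_mulmx _ _) _; rewrite ler_wpM2l //.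
  exact: opnorm_ub.
(* On the unit ball, Cauchy-Schwarz bounds |X v|^2 = |<X^* X v, v>| by the norm of X^* X. *)
- move=> X; have h : mx_opnorm X <= Num.sqrt (mx_opnorm (mst X *m X)).
    apply: opnorm_le => v v1; rewrite ler_sqrt //.
    rewrite ip_mulmx mulmxA; apply: le_trans (nrm_ip _ _) _.
    rewrite -[leRHS]mulr1; apply: ler_pM; rewrite ?vn_ge0 //.
    exact: opnorm_ub.
  by rewrite -[leRHS]sqr_sqrtr // ler_pXn2r ?nnegrE ?sqrtr_ge0.
- move=> u cu.
  have /choice [l hl] : forall ij : 'I_n * 'I_n, exists l, forall e, 0 < e ->
      exists N, forall k, (N <= k)%N -> nrm (u k ij.1 ij.2 - l) < e.
    move=> [i j]; apply: (ca_complete ca) => e e0; have [N hN] := cu e e0.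
    exists N => k m Nk Nm; apply: le_lt_trans (hN k m Nk Nm).
    by have := nrm_opnorm (u k - u m) i j; rewrite !mxE.
  exists (\matrix_(i, j) l (i, j)) => e e0.
  (* The errors of n^2 entries add up; the successor keeps the divisor nonzero for n = 0 and the
     total strictly below [e]. *)
  have e'0 : 0 < e / (n * n).+1%:R by rewrite divr_gt0 ?ltr0n.
  have /choice [N hN] : forall ij, exists N, forall k, (N <= k)%N ->
      nrm (u k ij.1 ij.2 - l ij) < e / (n * n).+1%:R.
    by move=> ij; exact: hl.
  exists (\max_ij N ij) => k Nk; apply: le_lt_trans (opnorm_crude _) _.
  apply: (@le_lt_trans _ _ (\sum_(i < n) \sum_(j < n) e / (n * n).+1%:R)).
    apply: ler_sum => i _; apply: ler_sum => j _; rewrite !mxE ltW //.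
    by apply: (hN (i, j)); apply: leq_trans Nk; exact: leq_bigmax.
  rewrite !sumr_const !card_ord -mulrnA -[ltLHS]mulr_natr -mulrA gtr_pMr //.
  by rewrite ltr_pdivrMl ?ltr0n // mulr1 ltr_nat.
Qed.

End MatrixCstar.


(** * Real-valued norms, and C*-algebras as models of the axioms *)

Section Rnorm.
Context {R : realType} (V : normedModType R[i]).
Implicit Types x y : V.

Lemma rnormE x : `|x| = (rnorm x)%:C.
Proof. by rewrite RRe_real // ger0_real. Qed.

Lemma rnorm_ge0 x : 0 <= rnorm x.
Proof. by rewrite -ler0c -rnormE. Qed.

Lemma rnorm0_eq0 x : rnorm x = 0 -> x = 0.
Proof. by move=> x0; apply/normr0_eq0; rewrite rnormE x0. Qed.

Lemma rnorm0 : rnorm (0 : V) = 0.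
Proof. by rewrite /rnorm normr0. Qed.

Lemma rnormD x y : rnorm (x + y) <= rnorm x + rnorm y.
Proof. by rewrite -lecR rmorphD /= -!rnormE ler_normD. Qed.

Lemma rnormZ (k : R[i]) x : rnorm (k *: x) = complex.Re `|k| * rnorm x.
Proof.
apply: complexI.
by rewrite rmorphM /= -!rnormE normrZ.
Qed.

Lemma rnorm_closureP (S : set V) x : closure S x <->
  forall e, 0 < e -> exists2 y, S y & rnorm (x - y) < e.
Proof.
split=> [Sx e e0|H B].
  have e0C : 0 < e%:C by rewrite -(rmorph0 (real_complex R)) ltcR.
  have [y [Sy]] := Sx _ (nbhsx_ballx x e%:C e0C).
  by rewrite -ball_normE /= rnormE ltcR => xy; exists y.
move/nbhs_ballP => [e /= e0 eB].
have eE : e = (complex.Re e)%:C by rewrite RRe_real // gtr0_real.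
rewrite eE -(rmorph0 (real_complex R)) ltcR in e0.
have [y Sy xy] := H _ e0; exists y; split=> //; apply: eB.
by rewrite -ball_normE /= rnormE eE ltcR.
Qed.

End Rnorm.

Lemma Re_norm_real {R : realType} (c : R) : complex.Re `|c%:C| = `|c|.
Proof. by rewrite normc_def /= expr0n addr0 sqrtr_sqr. Qed.

Section CstarScalars.
Context {R : realType} (A : cstarType R).

Definition cstar_real (c : R) : A := c%:C *: (1 : A).

Fact cstar_real_is_zmod_morphism : zmod_morphism cstar_real.
Proof. by move=> x y; rewrite /cstar_real rmorphB scalerBl. Qed.

Fact cstar_real_is_monoid_morphism : monoid_morphism cstar_real.
Proof.
split=> [|x y]; rewrite /cstar_real ?scale1r //.
by rewrite -cstar_scalerAl mul1r scalerA rmorphM.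
Qed.

HB.instance Definition _ := GRing.isZmodMorphism.Build R A cstar_real
  cstar_real_is_zmod_morphism.
HB.instance Definition _ := GRing.isMonoidMorphism.Build R A cstar_real
  cstar_real_is_monoid_morphism.

Lemma cstar_axioms_of : cstar_axioms cstar_real ('i%C *: (1 : A)) star (@rnorm R A).
Proof.
split=> //=.
- by move=> c x; rewrite /cstar_real -cstar_scalerAl -cstar_scalerAr mul1r mulr1.
- by move=> x; rewrite -cstar_scalerAl -cstar_scalerAr mul1r mulr1.
- by rewrite -cstar_scalerAl mul1r scalerA -expr2 sqr_i scaleN1r.
- by move=> c; rewrite /cstar_real starZ star1; congr (_ *: _); exact: conjc_real.
- rewrite starZ star1 -scaleNr; congr (_ *: _).
  by apply/eqP; rewrite eq_complex /= oppr0 !eqxx.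
- exact: starK.
- exact: starD.
- exact: starM.
- exact: rnorm_ge0.
- exact: rnorm0_eq0.
- exact: rnormD.
- by move=> c x; rewrite /cstar_real -cstar_scalerAl mul1r rnormZ Re_norm_real.
- by move=> x y; rewrite -lecR rmorphM /= -!rnormE cstar_normM.
- by move=> x; rewrite -lecR rmorphXn /= -!rnormE cstar_norm.
- move=> u cu.
  have : cauchy (u @ \oo).
    apply/cauchyP => e e0.
    have eE : e = (complex.Re e)%:C by rewrite RRe_real // gtr0_real.
    rewrite eE -(rmorph0 (real_complex R)) ltcR in e0.
    have [N hN] := cu _ e0; exists (u N); exists N => // n /= Nn.
    by rewrite -ball_normE /= rnormE eE ltcR hN.
  move/cauchy_cvg => /cvg_ex [l ul]; exists l => e e0.
  have e0C : 0 < e%:C by rewrite -(rmorph0 (real_complex R)) ltcR.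
  move/cvgrPdist_lt/(_ _ e0C): ul => -[N _ hN]; exists N => n Nn.
  by have := hN n Nn; rewrite distrC rnormE ltcR.
Qed.

End CstarScalars.


(** * Completely positive maps *)

Section LinearMaps.
Context {R : realType} (U W : lmodType R[i]) (f : U -> W).
Hypothesis f_lin : linear f.

Lemma linear_map0 : f 0 = 0.
Proof. by have := f_lin (-1) 0 0; rewrite scaler0 addr0 scaleN1r addNr. Qed.

Lemma linear_mapD x y : f (x + y) = f x + f y.
Proof. by have := f_lin 1 x y; rewrite !scale1r. Qed.

Lemma linear_mapZ k x : f (k *: x) = k *: f x.
Proof. by have := f_lin k x 0; rewrite !addr0 linear_map0 addr0. Qed.

Lemma linear_mapN x : f (- x) = - f x.
Proof. by rewrite -scaleN1r linear_mapZ scaleN1r. Qed.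

Lemma linear_mapB x y : f (x - y) = f x - f y.
Proof. by rewrite linear_mapD linear_mapN. Qed.

Lemma linear_map_sum (I : Type) (r : seq I) (P : pred I) (F : I -> U) :
  f (\sum_(i <- r | P i) F i) = \sum_(i <- r | P i) f (F i).
Proof. exact: (big_morph f linear_mapD linear_map0). Qed.

End LinearMaps.

Section UcpMaps.
Context {R : realType} (B C : cstarType R) (f : B -> C).
Hypothesis f_ucp : @ucp R (opsys_of_cstar B) (opsys_of_cstar C) f.
Let f_lin : linear f. Proof. by case: f_ucp. Qed.

(** The matrix with first row x and zeros elsewhere has X^* X = (x_i^* x_j). Complete positivity
    factors the image as Y^* Y, and the columns of Y are the vectors sought. They play the part of a
    Stinespring dilation in what follows. *)
Lemma ucp_gram n (x : 'I_n.+1 -> B) : exists Y : 'I_n.+1 -> 'cV[C]_n.+1,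
  forall i j, f (star (x i) * x j) = ip star (Y i) (Y j).
Proof.
pose X : 'M[B]_n.+1 := \matrix_(k, i) if k == 0 then x i else 0.
have [_ _ /(_ _ (mxstar X *m X))] := f_ucp; case.
  by exists X; rewrite /= map_mx_id.
rewrite /= map_mx_id // => Y fXY; exists (fun i => col i Y) => i j.
have := congr1 (fun M : 'M[C]_(n.+1) => M i j) fXY; rewrite !mxE.
rewrite (bigD1 ord0) //= big1 ?addr0 => [|k /negPf k0]; last first.
  by rewrite !mxE k0 mulr0.
by rewrite !mxE eqxx => ->; apply: eq_bigr => k _; rewrite !mxE.
Qed.

Let f1 : f 1 = 1. Proof. by case: f_ucp. Qed.

Lemma ucp_star x : f (star x) = star (f x).
Proof.
have [Y YE] := ucp_gram (fun i : 'I_2 => if i == 0 then 1 else x).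
have := YE 0 1; have := YE 1 0; rewrite /= !star1 mulr1 mul1r => -> ->.
by rewrite (st_ip (cstar_axioms_of C)).
Qed.

(** On positive h this follows from h <= |h| and f 1 = 1; in general, Cauchy-Schwarz for the Gram
    vectors of 1 and x bounds |f x|^2 by |f 1| |f(x^* x)|. *)
Lemma ucp_rnorm x : rnorm (f x) <= rnorm x.
Proof.
have ca := cstar_axioms_of C.
have pos_le (h : B) : ca_pos star h -> rnorm (f h) <= rnorm h.
  move=> hp; have fp (k : B) : ca_pos star k -> ca_pos star (f k).
    move=> [z zz ->]; have [Y YE] := ucp_gram (fun i : 'I_1 => z).
    by have := YE 0 0; rewrite zz => ->; exact: (ip_pos ca).
  apply: (ca_pos_le ca) => //; [exact: fp | | exact: rnorm_ge0].
  have -> : cstar_real C (rnorm h) - f h = f (cstar_real B (rnorm h) - h).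
    by rewrite (linear_mapB f_lin) /cstar_real (linear_mapZ f_lin) f1.
  apply: fp; apply: (ca_sa_le (cstar_axioms_of B)).
  exact: (ca_pos_sa (cstar_axioms_of B) hp).
have [Y YE] := ucp_gram (fun i : 'I_2 => if i == 0 then 1 else x).
have := ip_CS ca (Y 0) (Y 1); rewrite -!YE /= star1 !mul1r f1.
move=> h; rewrite -(@ler_pXn2r _ 2) ?nnegrE ?rnorm_ge0 //.
apply: le_trans h _; apply: (@le_trans _ _ (1 * rnorm (star x * x))).
  apply: ler_pM; rewrite ?rnorm_ge0 //; first exact: (ca_nrm1 ca).
  exact/pos_le/(ca_pos_star_mul (cstar_axioms_of B)).
by rewrite mul1r (ca_nrm_sq (cstar_axioms_of B)).
Qed.

(** The hypothesis says that the Gram vector of x is 0, so its inner product with that of y^*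
    vanishes. *)
Lemma ucp_null x y : f (star x * x) = 0 -> f (y * x) = 0.
Proof.
move=> x0; have [Y YE] := ucp_gram (fun i : 'I_2 => if i == 0 then star y else x).
have ca := cstar_axioms_of C.
have Y0 : forall k, Y 1 k 0 = 0.
  by apply: (ca_sum_star_mul_eq0 ca); have := YE 1 1; rewrite /= x0.
have := YE 0 1; rewrite /= starK => ->.
by rewrite /ip big1 // => k _; rewrite Y0 mulr0.
Qed.

(* The Gram vector of [a] is that of [1] multiplied by [f a] on the right. *)
Lemma ucp_multiplicative a y : f (star a * a) = star (f a) * f a ->
  f (y * a) = f y * f a.
Proof.
move=> fa; have ca := cstar_axioms_of C.
pose x (i : 'I_3) := nth 0 [:: 1; a; star y] i.
have [Y YE] := ucp_gram x.
pose i1 : 'I_3 := lift ord0 ord0; pose i2 : 'I_3 := ord_max.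
pose z := Y i1 - rscale (Y 0) (f a).
have z0 : ip star z z = 0.
  have Y11 : ip star (Y i1) (Y i1) = star (f a) * f a by rewrite -YE.
  have Y10 : ip star (Y i1) (Y 0) = star (f a).
    by rewrite -YE /x /= mulr1 ucp_star.
  have Y01 : ip star (Y 0) (Y i1) = f a by rewrite -YE /x /= star1 mul1r.
  have Y00 : ip star (Y 0) (Y 0) = 1 by rewrite -YE /x /= star1 mul1r.
  rewrite ipDr ipNr !(ipDl ca) !(ipNl ca) ip_rscaler !(ip_rscalel ca).
  by rewrite ip_rscaler Y11 Y10 Y01 Y00 mul1r !subrr.
have Yk : forall k, Y i1 k 0 = Y 0 k 0 * f a.
  move=> k; apply/eqP; rewrite -subr_eq0; apply/eqP.
  by have := ca_sum_star_mul_eq0 ca z0 k; rewrite !mxE.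
have := YE i2 i1; rewrite /x /= starK => ->.
have := YE i2 0; rewrite /x /= starK mulr1 => ->.
by rewrite -ip_rscaler /ip; apply: eq_bigr => k _; rewrite Yk mxE.
Qed.

End UcpMaps.

Lemma closure_linear_eq0 {R : realType} (U W : normedModType R[i]) (f : U -> W)
    (S : set U) (C : R) : linear f -> 0 <= C ->
  (forall x, rnorm (f x) <= C * rnorm x) -> (forall x, S x -> f x = 0) ->
  forall x, closure S x -> f x = 0.
Proof.
move=> f_lin C0 fC fS x /rnorm_closureP Sx; apply: rnorm0_eq0; apply/eqP.
rewrite eq_le rnorm_ge0 andbT; apply/ler_addgt0Pr => e e0; rewrite add0r.
have C1 : 0 < C + 1 by lra.
have [y Sy xy] := Sx (e / (C + 1)) (divr_gt0 e0 C1).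
have -> : f x = f (x - y) by rewrite (linear_mapB f_lin) (fS y Sy) subr0.
apply: le_trans (fC _) _; rewrite ltr_pdivlMr // in xy.
have := rnorm_ge0 (x - y); nra.
Qed.

(** * Crossed products: from the intersection property to faithfulness *)

Section CrossedProduct.
Context {R : realType} {G : groupType} {A : cstar_dynsys R G}.
Variable B : reduced_crossed_product A.

(** An element x of A is a sum supported at the identity of G. The regular representation applied to
    a vector w placed at the identity has coordinate [p x w] there, so zero reduced norm forces p x
    = 0. *)
Lemma rcp_incl_inj : injective (rcp_incl B).
Proof.
have [iL _ _ _] := rcp_incl_hom B.
suff i0 x : rcp_incl B x = 0 -> x = 0.
  move=> x y xy; apply/eqP; rewrite -subr_eq0; apply/eqP/i0.
  by rewrite (linear_mapB iL) xy subrr.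
move=> x0; have [H [p [[plin pD _ _ pinj] pnorm]]] := rcp_norm B.
have := pnorm [fset 1%g]%fset (fun=> x); rewrite big_seq_fset1 x0 mul0r rnorm0.
move=> /esym N0; apply: pinj; apply/funext => v.
have pv0 w : p 0 w = 0.
  have := pD (-1) 0 0 w; rewrite scaler0 addr0 scaleN1r addNr; exact.
rewrite pv0.
suff small w : rnorm w <= 1 -> p x w = 0.
  (* The reduced norm only tests the unit ball, so v is first scaled into it. *)
  pose c : R := (1 + rnorm v)^-1.
  have v1 : 0 < 1 + rnorm v by rewrite ltr_pwDl // rnorm_ge0.
  have c0 : c%:C != 0 by rewrite (inj_eq (@complexI R) c 0) invr_eq0 gt_eqF.
  have /small : rnorm (c%:C *: v) <= 1.
    rewrite rnormZ Re_norm_real gtr0_norm ?invr_gt0 //.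
    by rewrite ler_pdivrMl // mulr1 lerDr.
  rewrite (linear_mapZ (plin x).1) => /eqP; rewrite scaler_eq0 (negPf c0) /=.
  by move/eqP.
move=> w1; pose xi (t : G) : H := if t == 1%g then w else 0.
have xi1 : (l2norm xi <= 1)%E.
  rewrite /l2norm (_ : esum _ _ = ((rnorm w) ^+ 2)%:E).
    rewrite /= lee_fin -sqrtr1 ler_wsqrtr // expr_le1 // rnorm_ge0.
    by [].
  rewrite -(@esum_set1 R G 1%g (fun=> ((rnorm w) ^+ 2)%:E)) ?lee_fin ?sqr_ge0 //.
  rewrite [RHS]esum_mkcond; apply: eq_esum => t _; rewrite /xi.
  by case: eqP => [->|t1]; [rewrite mem_set | rewrite memNset // rnorm0 expr0n].
have : (l2norm (regular_rep p [fset 1%g]%fset (fun=> x) xi) <= 0)%E.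
  by rewrite -[leRHS]/(0%:E) -N0; apply: ereal_sup_ubound; exists xi.
set eta := regular_rep _ _ _ _; rewrite /l2norm.
have eta1 : eta 1%g = p x w.
  rewrite /eta /regular_rep big_seq_fset1 invg1 mulg1 cds_act1 /xi eqxx.
  by [].
move=> le0; apply: rnorm0_eq0; apply/eqP; rewrite -sqrf_eq0 eq_le sqr_ge0 andbT.
rewrite -lee_fin -eta1.
rewrite -(@esum_set1 R G 1%g (fun t => ((rnorm (eta t)) ^+ 2)%:E)); last first.
  by rewrite lee_fin sqr_ge0.
have es0 : (\esum_(t in [set: G]) ((rnorm (eta t)) ^+ 2)%:E <= 0)%E.
  by rewrite -lee_sqrt // sqrte0.
apply: le_trans es0; rewrite esum_mkcond; apply: le_esum => t _.
by case: ifP => _ //; rewrite lee_fin sqr_ge0.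
Qed.

Lemma intersection_property_faithful (I : injective_hull A) (phi : B -> I) :
  intersection_property B -> pseudo_expectation phi -> faithful phi.
Proof.
move=> ip [[phi_ucp phi_eq] phiA] x phix0.
have phi_lin : linear phi by case: phi_ucp.
have [iL iM _ iS] := rcp_incl_hom B.
have [hL hM _ hS] := hull_incl_hom I.
pose J : set B := [set x : B | forall y z, phi (y * x * z) = 0].
have phi_null w z : phi (w * x * z) = 0.
  have : closure [set x : B | exists (F : {fset G}) (a : G -> A),
      x = \sum_(s <- F) rcp_incl B (a s) * rcp_unitary B s] z.
    by rewrite rcp_dense.
  apply: (@closure_linear_eq0 R B I (fun z => phi (w * x * z)) _ (rnorm (w * x))).
  - move=> k u v; rewrite mulrDr -cstar_scalerAr.
    by rewrite (linear_mapD phi_lin) (linear_mapZ phi_lin).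
  - exact: rnorm_ge0.
  - move=> u; apply: le_trans (ucp_rnorm phi_ucp _) _.
    exact: (ca_nrmM (cstar_axioms_of B)).
  move=> _ [F [a ->]]; rewrite mulr_sumr (linear_map_sum phi_lin) big1 // => s _.
  (* Conjugation moves the unitary u_s to the far left: w x a u_s is the conjugate by s^-1 of u_s w
     x a. Equivariance then leaves phi(u_s w x a) = phi(u_s w x) phi(a) = 0. *)
  have -> : w * x * (rcp_incl B (a s) * rcp_unitary B s) =
      rcp_conj s^-1%g (rcp_unitary B s * w * x * rcp_incl B (a s)).
    have uV : rcp_unitary B s^-1%g = star (rcp_unitary B s).
      rewrite -[LHS]mulr1 -(rcp_unitaryr B s) mulrA -rcp_unitaryM mulVg.
      by rewrite rcp_unitary1 mul1r.
    by rewrite /rcp_conj uV starK !mulrA rcp_unitaryl mul1r.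
  have := phi_eq s^-1%g (rcp_unitary B s * w * x * rcp_incl B (a s)).
  rewrite /= => ->; rewrite (ucp_multiplicative phi_ucp); last first.
    by rewrite -iS -iM !phiA hM hS.
  rewrite (ucp_null phi_ucp _ phix0) mul0r.
  by have [aL _ _ _] := cds_act_hom I s^-1%g; rewrite (linear_map0 aL).
have J_ideal : cstar_ideal J.
  split=> /=.
  - by move=> y z; rewrite mulr0 mul0r (linear_map0 phi_lin).
  - move=> u v Ju Jv y z.
    by rewrite mulrDr mulrDl (linear_mapD phi_lin) Ju Jv addr0.
  - move=> k u Ju y z.
    by rewrite -cstar_scalerAr -cstar_scalerAl (linear_mapZ phi_lin) Ju scaler0.
  - move=> u v Jv; split=> y z; first by rewrite mulrA Jv.
    by rewrite mulrA -mulrA Jv.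
  - move=> u /= Ju y z; move: u Ju.
    apply: (@closure_linear_eq0 R B I (fun u => phi (y * u * z)) _
      (rnorm y * rnorm z)).
    + move=> k u v; rewrite mulrDr mulrDl -cstar_scalerAr -cstar_scalerAl.
      by rewrite (linear_mapD phi_lin) (linear_mapZ phi_lin).
    + by rewrite mulr_ge0 ?rnorm_ge0.
    + have ca := cstar_axioms_of B.
      move=> u; apply: le_trans (ucp_rnorm phi_ucp _) _.
      apply: le_trans (ca_nrmM ca _ _) _; rewrite mulrAC.
      by apply: ler_pM; rewrite ?rnorm_ge0 // (ca_nrmM ca).
    + by move=> u; exact.
apply/eqP; apply: contraT => x0.
have [|a Ja] := ip J J_ideal; first by exists x.
have [_ [inj _]] := (hull_essential I).1.
have : hull_incl I a = 0 by have := Ja 1 1; rewrite mul1r mulr1 phiA.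
by rewrite -(linear_map0 hL) => /inj ->; rewrite (linear_map0 iL) eqxx.
Qed.

End CrossedProduct.


(** * Closed ideals and extensions from A + J *)

Section Ideals.
Context {R : realType} (B : cstarType R) (J : set B).
Hypothesis J_ideal : cstar_ideal J.

Lemma cstar_ideal0 : J 0. Proof. by case: J_ideal. Qed.
Lemma cstar_idealD x y : J x -> J y -> J (x + y).
Proof. by case: J_ideal => _ + _ _ _; exact. Qed.
Lemma cstar_idealZ (k : R[i]) x : J x -> J (k *: x).
Proof. by case: J_ideal => _ _ + _ _; exact. Qed.
Lemma cstar_idealMl x y : J y -> J (x * y).
Proof. by case: J_ideal => _ _ _ h _ /(h x) []. Qed.
Lemma cstar_idealMr x y : J x -> J (x * y).
Proof. by case: J_ideal => _ _ _ h _ /(h y) []. Qed.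
Lemma cstar_idealN x : J x -> J (- x).
Proof. by move=> Jx; rewrite -scaleN1r; exact: cstar_idealZ. Qed.
Lemma cstar_idealB x y : J x -> J y -> J (x - y).
Proof. by move=> Jx /cstar_idealN; exact: cstar_idealD. Qed.

Lemma cstar_ideal_closed x : closure J x -> J x.
Proof. by case: J_ideal => _ _ _ _; exact. Qed.

Definition mx_ideal n (K : 'M[B]_n) := forall i j, J (K i j).

Lemma mx_ideal_mul n (X K Y : 'M[B]_n) : mx_ideal K -> mx_ideal (X *m K *m Y).
Proof.
have Jsum (F : 'I_n -> B) : (forall i, J (F i)) -> J (\sum_i F i).
  by move=> JF; elim/big_ind: _ => //; [exact: cstar_ideal0 | exact: cstar_idealD].
move=> JK i j; rewrite mxE; apply: (Jsum _) => k; apply: cstar_idealMr.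
by rewrite mxE; apply: (Jsum _) => l; exact: cstar_idealMl.
Qed.

(** By [ca_hereditary], D = D g + t D K g, where the last term has entries in J and D g has norm at
    most 1 / (2 sqrt t). The choice t = e^-2 makes this e / 2, and J is closed. *)
Lemma mx_ideal_hereditary n (K D : 'M[B]_n) : mx_ideal K ->
  mxpos (K - mxstar D *m D) -> mx_ideal D.
Proof.
move=> JK /(ca_pos_starP (mx_cstar_axioms (cstar_axioms_of B) n) _).2 KD i j.
apply: cstar_ideal_closed; apply/rnorm_closureP => e e0.
have t0 : 0 < (e ^+ 2)^-1 by rewrite invr_gt0 exprn_gt0.
have [g [Dg g1]] := ca_hereditary (mx_cstar_axioms (cstar_axioms_of B) n) t0 KD.
pose X : 'M[B]_n := (cstar_real B (e ^+ 2)^-1)%:M.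
exists ((D *m X *m K *m g) i j).
  exact: mx_ideal_mul.
have DE : D - D *m X *m K *m g = D * g.
  have DE : D = D * g + D *m X *m K *m g.
    rewrite -[LHS]mulr1 [in LHS]g1 mulrDr; congr (_ + _).
    by rewrite -!mulmxE !mulmxA.
  by rewrite [X in X - _]DE addrK.
have -> : D i j - (D *m X *m K *m g) i j = (D * g) i j by rewrite -DE !mxE.
apply: le_lt_trans (nrm_opnorm (cstar_axioms_of B) _ _ _) _.
rewrite -(@ltr_pXn2r _ 2) ?nnegrE ?(opnorm_ge0 (cstar_axioms_of B)) ?ltW //.
apply: le_lt_trans Dg _; rewrite invfM invrK.
by have : 0 < e ^+ 2 := exprn_gt0 2 e0; lra.
Qed.

(** Heredity for 1 x 1 matrices with D = x^*: here D^* D = x x^* is already in J. *)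
Lemma cstar_ideal_star x : J x -> J (star x).
Proof.
move=> Jx; have := @mx_ideal_hereditary 1 (x * star x)%:M (star x)%:M.
move=> h; have := h _ _ 0 0; rewrite mxE eqxx mulr1n; apply.
  by move=> i j; rewrite mxE; case: eqP => _; rewrite ?mulr1n ?mulr0n;
     [exact: cstar_idealMr | exact: cstar_ideal0].
exists 0; rewrite mulmx0; apply/eqP; rewrite subr_eq0; apply/eqP/matrixP => i j.
by rewrite !mxE big_ord1 !mxE !ord1 eqxx !mulr1n starK.
Qed.

End Ideals.

Section StarHomMatrix.
Context {R : realType} (A B : cstarType R) (f : A -> B).
Hypothesis f_hom : star_hom f.
Let f_lin : linear f. Proof. by case: f_hom. Qed.

Lemma map_mx_homM n (X Y : 'M[A]_n) :
  map_mx f (X *m Y) = map_mx f X *m map_mx f Y.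
Proof.
case: f_hom => _ fM _ _; apply/matrixP => i j.
rewrite !mxE (linear_map_sum f_lin); apply: eq_bigr => k _.
by rewrite fM !mxE.
Qed.

Lemma map_mx_hom_star n (X : 'M[A]_n) : map_mx f (mxstar X) = mxstar (map_mx f X).
Proof. by case: f_hom => _ _ _ fS; apply/matrixP => i j; rewrite !mxE fS. Qed.

Lemma map_mx_homN n (X : 'M[A]_n) : map_mx f (- X) = - map_mx f X.
Proof. by apply/matrixP => i j; rewrite !mxE (linear_mapN f_lin). Qed.

(* If [X = X+ - X-] is not positive then conjugating by [X-] puts [(X-)^3] below
   an element of the ideal. *)
Lemma mxpos_mod_ideal (J : set B) n (X : 'M[A]_n) (K : 'M[B]_n) :
  cstar_ideal J -> (forall a, J (f a) -> a = 0) -> mx_ideal J K ->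
  mxpos (map_mx f X + K) -> mxpos X.
Proof.
move=> J_ideal fJ JK [Y XKY].
have caA := mx_cstar_axioms (cstar_axioms_of A) n.
have caB := mx_cstar_axioms (cstar_axioms_of B) n.
have sM (P Q : 'M[B]_n) : mxstar (P *m Q) = mxstar Q *m mxstar P := ca_stM caB P Q.
have sK (P : 'M[B]_n) : mxstar (mxstar P) = P := ca_stK caB P.
have sD (P Q : 'M[B]_n) : mxstar (P + Q) = mxstar P + mxstar Q := ca_stD caB P Q.
have fmxJ (W : 'M[A]_n) : mx_ideal J (map_mx f W) -> W = 0.
  move=> JW; apply/matrixP => i j; rewrite mxE; apply: fJ.
  by have := JW i j; rewrite mxE.
(* Self-adjointness of f(X) + K gives f(X^* - X) = K - K^*, whose entries lie in J; hence X^* - X =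
   0. *)
have sX : mxstar X = X.
  apply/eqP; rewrite -subr_eq0; apply/eqP/fmxJ.
  have -> : map_mx f (mxstar X - X) = K - mxstar K.
    have -> : map_mx f (mxstar X - X) = mxstar (map_mx f X) - map_mx f X.
      rewrite -map_mx_hom_star; apply/matrixP => i j.
      by rewrite !mxE (linear_mapB f_lin).
    have /eqP : mxstar (map_mx f X + K) = map_mx f X + K.
      by rewrite XKY sM sK.
    rewrite sD => E; apply/eqP; rewrite subr_eq eq_sym addrAC subr_eq.
    by rewrite addrC eq_sym.
  move=> i j; rewrite !mxE; apply: (cstar_idealB J_ideal) => //.
  exact: (cstar_ideal_star J_ideal).
have [N [sN NXN NX0]] := ca_neg_part caA sX.
apply/(ca_pos_starP caA)/NX0.
have [W WE] := (ca_pos_starP caA _).1 NXN.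
suff W0 : W = 0 by rewrite -[LHS]opprK WE W0 mulr0 oppr0.
apply: fmxJ; pose fN := map_mx f N.
(* With W^* W = - N X N, the difference fN K fN - f(W)^* f(W) is fN (f(X) + K) fN, the square of the
   modulus of Y fN. *)
apply: (mx_ideal_hereditary J_ideal (mx_ideal_mul J_ideal fN fN JK)).
have sfN : mxstar fN = fN by rewrite -map_mx_hom_star (sN : mxstar N = N).
exists (Y *m fN).
have -> : mxstar (map_mx f W) *m map_mx f W = - (fN *m map_mx f X *m fN).
  rewrite -map_mx_hom_star -map_mx_homM -!map_mx_homM -map_mx_homN.
  by congr map_mx; rewrite WE.
have -> : mxstar (Y *m fN) *m (Y *m fN) = fN *m (mxstar Y *m Y) *m fN.
  by rewrite sM sfN !mulmxA.
by rewrite opprK -XKY mulmxDr mulmxDl addrC.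
Qed.

End StarHomMatrix.


(** * The operator system A + J with its action *)

Section IdealExtension.
Context {R : realType} {G : groupType} {A : cstar_dynsys R G}.
Context {B : reduced_crossed_product A} {J : set B}.

Let incl_hom := rcp_incl_hom B.
Let incl_lin : linear (rcp_incl B). Proof. by case: incl_hom. Qed.

(* [A + J]; the proof argument is what lets the subspace structure be inferred. *)
Definition ideal_ext_pred of cstar_ideal J : {pred B} :=
  [pred x | `[< exists a, J (x - rcp_incl B a) >]].

Section Ideal.
Variable J_ideal : cstar_ideal J.
Local Notation P := (ideal_ext_pred J_ideal).

Fact ideal_ext_submod_closed : submod_closed P.
Proof.
split.
  apply/asboolP; exists 0; rewrite (linear_map0 incl_lin) subr0.
  exact: cstar_ideal0 J_ideal.
move=> k x y /asboolP[a Ja] /asboolP[b Jb]; apply/asboolP; exists (k *: a + b).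
have -> : k *: x + y - rcp_incl B (k *: a + b) =
          k *: (x - rcp_incl B a) + (y - rcp_incl B b).
  by rewrite incl_lin scalerBr opprD addrACA.
by apply: (cstar_idealD J_ideal) => //; exact: (cstar_idealZ J_ideal).
Qed.

HB.instance Definition _ := GRing.isSubmodClosed.Build R[i] B P
  ideal_ext_submod_closed.

Record ideal_ext := IdealExt { ideal_ext_val : B; _ : ideal_ext_val \in P }.

HB.instance Definition _ := [isSub for ideal_ext_val].
HB.instance Definition _ := [Choice of ideal_ext by <:].
HB.instance Definition _ := [SubChoice_isSubLmodule of ideal_ext by <:].

Lemma ideal_ext_incl (x : ideal_ext) : exists a, J (val x - rcp_incl B a).
Proof. exact/asboolP/(valP x). Qed.

Fact ideal_ext_emb_linear : linear (val : ideal_ext -> B).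
Proof. by move=> k x y; rewrite linearP. Qed.

Fact ideal_ext_one_subproof : (1 : B) \in P.
Proof.
apply/asboolP; exists 1; have [_ _ -> _] := incl_hom.
by rewrite subrr; exact: cstar_ideal0 J_ideal.
Qed.

Fact ideal_ext_star_subproof (x : ideal_ext) : star (val x) \in P.
Proof.
have [a Ja] := ideal_ext_incl x; apply/asboolP; exists (star a).
have [_ _ _ ->] := incl_hom.
by rewrite -(ca_stB (cstar_axioms_of B)); exact: (cstar_ideal_star J_ideal).
Qed.

Definition ideal_ext_star (x : ideal_ext) := IdealExt (ideal_ext_star_subproof x).

Definition ideal_ext_os : opsys R :=
  @Opsys R ideal_ext B val ideal_ext_emb_linear val_inj
    (IdealExt ideal_ext_one_subproof) (erefl _) ideal_ext_star (fun=> erefl _).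

Lemma ideal_ext_posE n (X : 'M[ideal_ext]_n) : @os_pos R ideal_ext_os n X <->
  @os_pos R (opsys_of_cstar B) n (map_mx (val : ideal_ext -> B) X).
Proof. by rewrite /os_pos /= map_mx_id. Qed.

Lemma ideal_conj s x : J x -> J (rcp_conj s x).
Proof.
move=> Jx; rewrite /rcp_conj; apply: (cstar_idealMr J_ideal).
exact: (cstar_idealMl J_ideal).
Qed.

Fact ideal_ext_conj_subproof s (x : ideal_ext) : rcp_conj s (val x) \in P.
Proof.
have [a Ja] := ideal_ext_incl x; apply/asboolP; exists (cds_act s a).
rewrite -rcp_covariant; have [L _ _ _] := rcp_conj_hom B s.
rewrite -[X in J (_ - X)]/(rcp_conj s (rcp_incl B a)) -(linear_mapB L).
exact: ideal_conj.
Qed.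

Definition ideal_ext_act s (x : ideal_ext_os) : ideal_ext_os :=
  IdealExt (ideal_ext_conj_subproof s x).

Fact ideal_ext_act_linear s : linear (ideal_ext_act s).
Proof.
move=> k x y; apply: val_inj; have [L _ _ _] := rcp_conj_hom B s.
exact: (L k (val x) (val y)).
Qed.

Fact ideal_ext_act_pos s n (X : 'M[ideal_ext_os]_n) :
  os_pos X -> os_pos (map_mx (ideal_ext_act s) X).
Proof.
move=> /ideal_ext_posE XP; apply/ideal_ext_posE.
have -> : map_mx (val : ideal_ext -> B) (map_mx (ideal_ext_act s) X) =
          map_mx (rcp_conj s) (map_mx (val : ideal_ext -> B) X).
  by apply/matrixP => i j; rewrite !mxE.
by have [_ _] := star_hom_ucp (rcp_conj_hom B s); exact.
Qed.

Fact ideal_ext_act1 x : ideal_ext_act 1%g x = x.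
Proof. by apply: val_inj; rewrite /= rcp_conj1. Qed.

Fact ideal_ext_actM s t x :
  ideal_ext_act (s * t)%g x = ideal_ext_act s (ideal_ext_act t x).
Proof. by apply: val_inj; rewrite /= rcp_conjM. Qed.

Fact ideal_ext_act_ucp s : ucp (ideal_ext_act s).
Proof.
split; [exact: ideal_ext_act_linear | | exact: ideal_ext_act_pos].
by apply: val_inj; have [_ _ E _] := rcp_conj_hom B s; rewrite /= E.
Qed.

Fact ideal_ext_act_coi s : complete_order_injection (ideal_ext_act s).
Proof.
have actK : cancel (ideal_ext_act s) (ideal_ext_act s^-1%g).
  by move=> x; rewrite -ideal_ext_actM mulVg ideal_ext_act1.
split; first exact: can_inj actK.
move=> n X; split; first exact: ideal_ext_act_pos.
by move/(@ideal_ext_act_pos s^-1%g); rewrite -map_mx_comp map_mx_id.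
Qed.

Definition ideal_ext_nds : nc_dynsys R G :=
  @NcDynsys R G ideal_ext_os ideal_ext_act ideal_ext_act_ucp ideal_ext_act_coi
    ideal_ext_act1 ideal_ext_actM.

Lemma ideal_ext_embedding :
  @nds_embedding R G ideal_ext_nds (nds_of_cds (rcp_cds B)) val.
Proof.
split; last by split; [exact: val_inj | exact: ideal_ext_posE].
split; last by [].
by split=> // n X /ideal_ext_posE.
Qed.

End Ideal.
End IdealExtension.

(** * Pseudo-expectations killing an ideal, and the equivalence *)

Theorem pseudo_expectation_vanishing (R : realType) (G : groupType)
    (A : cstar_dynsys R G) (B : reduced_crossed_product A)
    (I : injective_hull A) (J : set B) :
  cstar_ideal J -> (forall a, J (rcp_incl B a) -> a = 0) ->
  exists2 phi : B -> I, pseudo_expectation phi & forall x, J x -> phi x = 0.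
Proof.
move=> J_ideal incl_J.
have [iL iM i1 iS] := rcp_incl_hom B; have [hL hM h1 hS] := hull_incl_hom I.
have [q qJ] := choice (@ideal_ext_incl R G A B J J_ideal).
(* The chosen A-component is unique because A meets J trivially; linearity and equivariance of [q]
   follow by exhibiting the right component. *)
have q_uniq (x : ideal_ext J_ideal) a : J (val x - rcp_incl B a) -> q x = a.
  move=> Ja; apply/eqP; rewrite -subr_eq0; apply/eqP/incl_J.
  have := cstar_idealB J_ideal Ja (qJ x).
  by rewrite (linear_mapB iL) opprB addrC addrA subrK.
pose S := ideal_ext_nds J_ideal.
pose f (x : S) : I := hull_incl I (q x).
have q_lin : linear q.
  move=> k x y; apply: q_uniq; rewrite linearP /= iL.
  rewrite opprD addrACA -scalerBr; apply: (cstar_idealD J_ideal); last exact: qJ.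
  by apply: (cstar_idealZ J_ideal); exact: qJ.
have f_mor : @nds_morphism R G S (nds_of_cds I) f.
  split; first split.
  - by move=> k x y; rewrite /f q_lin hL.
  - by rewrite /f (@q_uniq _ 1) //= i1 subrr; exact: cstar_ideal0 J_ideal.
  - move=> n X XP.
    have qX : mxpos (map_mx q X).
      (* X is the image of its A-component plus K, and K has entries in J. *)
      pose K : 'M[B]_n := \matrix_(i, j)
        (val (X i j : ideal_ext J_ideal) - rcp_incl B (q (X i j))).
      apply: (@mxpos_mod_ideal _ _ _ _ (rcp_incl_hom B) J n _ K) => //.
      - by move=> i j; rewrite mxE.
      - case: XP => Y XY; exists Y; rewrite -XY; apply/matrixP => i j.
        by rewrite !mxE addrC subrK.
    case: qX => W qW; exists (map_mx (hull_incl I) W).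
    rewrite /= map_mx_id // -map_mxstar; last exact: hull_incl_hom.
    by rewrite -qW -map_mx_comp.
  - move=> s x; rewrite /f /= (@q_uniq _ (cds_act s (q x))).
      by have [[_ + ] _] := (hull_essential I).1; exact.
    rewrite /= -rcp_covariant; have [L _ _ _] := rcp_conj_hom B s.
    rewrite -[X in J (_ - X)]/(rcp_conj s (rcp_incl B (q x))) -(linear_mapB L).
    by apply: (ideal_conj J_ideal); exact: qJ.
have [phi phi_mor phif] :=
  @hull_injective R G A I S (nds_of_cds (rcp_cds B)) val f
    (ideal_ext_embedding J_ideal) f_mor.
(* Used twice: for x in A it gives the pseudo-expectation property, and for x in J, with a = 0, the
   vanishing. *)
have phiE (x : B) a : J (x - rcp_incl B a) -> phi x = hull_incl I a.
  move=> Ja; have xP : x \in ideal_ext_pred J_ideal by apply/asboolP; exists a.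
  by have := phif (IdealExt xP); rewrite /f (@q_uniq _ a).
exists phi => [|x Jx].
  by split=> // a; apply: phiE; rewrite subrr; exact: cstar_ideal0 J_ideal.
by rewrite (@phiE x 0) ?(linear_map0 hL) // (linear_map0 iL) subr0.
Qed.

Theorem theorem6p6 (R : realType) (G : groupType) (hG : countable [set: G])
    (A : cstar_dynsys R G) (B : reduced_crossed_product A)
    (I : injective_hull A) :
  intersection_property B <->
  forall phi : B -> I, pseudo_expectation phi -> faithful phi.
Proof.
split=> [ip phi|phi_faithful J J_ideal [x Jx x0]].
  exact: intersection_property_faithful.
apply: contrapT => noA.
(* The negated conclusion only says that the image of [a] is 0; injectivity of the inclusion gives a
   = 0. *)
have incl_J a : J (rcp_incl B a) -> a = 0.
  move=> Ja; apply: contrapT => /eqP a0; apply: noA; exists a => //.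
  apply: contra_neq a0 => ia0; apply: (@rcp_incl_inj _ _ _ B).
  by have [iL _ _ _] := rcp_incl_hom B; rewrite ia0 (linear_map0 iL).
have [phi phi_pe phiJ] := pseudo_expectation_vanishing I J_ideal incl_J.
move/eqP: x0; apply; apply: (phi_faithful phi phi_pe); apply: phiJ.
exact: (cstar_idealMl J_ideal).
Qed.
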